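(* Let $\mathcal{E}$ be an exact category for which there exist an artin algebra $\Lambda$ and a module $U\in\mathsf{mod}\,\Lambda$ of finite injective dimension such that $\mathcal{E}$ is equivalent, as an exact category, to ${}^{\perp}U$. Then $\mathcal{E}$ satisfies the Jordan-Hölder property (JHP) if and only if the number of isomorphism classes of simple objects in $\mathcal{E}$ is equal to the number of isomorphism classes of indecomposable projective objects in $\mathcal{E}$.
   Context: An artin algebra is an algebra over a fixed commutative artinian ring $R$ that is finitely generated as an $R$-module; $\mathsf{mod}\,\Lambda$ is the category of finitely generated right $\Lambda$-modules. For $U\in\mathsf{mod}\,\Lambda$, ${}^\perp U$ is the full subcategory of all $X\in\mathsf{mod}\,\Lambda$ with $\operatorname{Ext}^i_\Lambda(X,U)=0$ for all $i>0$. It is extension-closed and is regarded as an exact category whose conflations are the short exact sequences of $\mathsf{mod}\,\Lambda$ with all terms in it. Projective objects of $\mathcal{E}$ are projective with respect to its exact structure. For an exact category $\mathcal{E}$ and an object $X$, $\mathsf{P}(X)$ is the poset of admissible subobjects: its elements are inflations $A\to X$ up to isomorphism over $X$, and $A\leq B$ if there is an inflation $A\to B$ compatible with the inflations to $X$; $X/A$ is the cokernel of $A\to X$. $X$ is simple if $X\ne 0$ and there is no conflation $L\to X\to N$ with $L,N\neq 0$. $\mathcal{E}$ is length if for every $X$ the set of lengths of finite chains in $\mathsf{P}(X)$ is bounded (every extension-closed subcategory of $\mathsf{mod}\,\Lambda$ is length). A composition series of $X$ is a finite maximal chain $0=X_0<\cdots<X_n=X$ in $\mathsf{P}(X)$.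 Two composition series $(X_i)_{i=0}^n$, $(Y_j)_{j=0}^m$ are isomorphic if $m=n$ and there is a permutation $\sigma$ of $\{1,\dots,n\}$ with $X_i/X_{i-1}\cong Y_{\sigma(i)}/Y_{\sigma(i)-1}$ for all $i$. A length exact category satisfies (JHP) if for every object $X$ all composition series of $X$ are isomorphic to each other. *)

(* Defs.v *)
From HB Require Import structures.
From mathcomp Require Import all_boot all_order all_algebra perm.
From mathcomp Require Import boolp classical_sets.

Set Implicit Arguments.
Unset Strict Implicit.
Unset Printing Implicit Defensive.

Import GRing.Theory.

Local Open Scope ring_scope.
Local Open Scope classical_set_scope.

(* A preadditive category with a distinguished class of composable pairs;
   the axioms on that class are collected in [is_exact].  [comp g f] is
   "g after f". *)
Record preexact := Preexact {
  obj :> Type;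
  hom : obj -> obj -> zmodType;
  idm : forall X, hom X X;
  comp : forall X Y Z, hom Y Z -> hom X Y -> hom X Z;
  compA : forall W X Y Z (h : hom Y Z) (g : hom X Y) (f : hom W X),
    comp h (comp g f) = comp (comp h g) f;
  comp1m : forall X Y (f : hom X Y), comp (idm Y) f = f;
  compm1 : forall X Y (f : hom X Y), comp f (idm X) = f;
  compDl : forall X Y Z (g g' : hom Y Z) (f : hom X Y),
    comp (g + g') f = comp g f + comp g' f;
  compDr : forall X Y Z (g : hom Y Z) (f f' : hom X Y),
    comp g (f + f') = comp g f + comp g f';
  conflation : forall X Y Z, hom X Y -> hom Y Z -> Prop
}.

Notation "g ∘ f" := (comp g f) (at level 40, left associativity) : ring_scope.

Section ExactCategories.
Variable E : preexact.

Definition iso_mor (X Y : E) (f : hom X Y) : Prop :=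
  exists2 g : hom Y X, g ∘ f = idm X & f ∘ g = idm Y.

Definition isomorphic (X Y : E) : Prop := exists f : hom X Y, iso_mor f.

Definition zero_obj (X : E) : Prop :=
  (forall Y (f : hom X Y), f = 0) /\ (forall Y (f : hom Y X), f = 0).

Definition biproduct (A B S : E) : Prop :=
  exists (i : hom A S) (j : hom B S) (p : hom S A) (q : hom S B),
    [/\ p ∘ i = idm A, q ∘ j = idm B, p ∘ j = 0, q ∘ i = 0 &
        i ∘ p + j ∘ q = idm S].

Definition inflation (X Y : E) (f : hom X Y) : Prop :=
  exists Z (g : hom Y Z), conflation f g.

Definition deflation (Y Z : E) (g : hom Y Z) : Prop :=
  exists X (f : hom X Y), conflation f g.

Definition kernel_of (X Y Z : E) (f : hom X Y) (g : hom Y Z) : Prop :=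
  g ∘ f = 0 /\
  forall W (h : hom W Y), g ∘ h = 0 -> exists! k : hom W X, f ∘ k = h.

Definition cokernel_of (X Y Z : E) (f : hom X Y) (g : hom Y Z) : Prop :=
  g ∘ f = 0 /\
  forall W (h : hom Y W), h ∘ f = 0 -> exists! k : hom Z W, k ∘ g = h.

Definition pushout (A B A' B' : E)
    (i : hom A B) (f : hom A A') (i' : hom A' B') (f' : hom B B') : Prop :=
  f' ∘ i = i' ∘ f /\
  forall W (u : hom B W) (v : hom A' W), u ∘ i = v ∘ f ->
    exists! w : hom B' W, w ∘ f' = u /\ w ∘ i' = v.

Definition pullback (B C B' C' : E)
    (p : hom B C) (f : hom C' C) (p' : hom B' C') (f' : hom B' B) : Prop :=
  p ∘ f' = f ∘ p' /\
  forall W (u : hom W B) (v : hom W C'), p ∘ u = f ∘ v ->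
    exists! w : hom W B', f' ∘ w = u /\ p' ∘ w = v.

(* Quillen's axioms, in the form of Bühler's "Exact categories". *)
Record is_exact : Prop := IsExact {
  has_zero : exists Z : E, zero_obj Z;
  has_biproducts : forall A B : E, exists S, biproduct A B S;
  conflation_ker : forall (X Y Z : E) (f : hom X Y) (g : hom Y Z),
    conflation f g -> kernel_of f g;
  conflation_coker : forall (X Y Z : E) (f : hom X Y) (g : hom Y Z),
    conflation f g -> cokernel_of f g;
  conflation_iso : forall (X Y Z X' Y' Z' : E)
      (f : hom X Y) (g : hom Y Z) (f' : hom X' Y') (g' : hom Y' Z')
      (a : hom X X') (b : hom Y Y') (c : hom Z Z'),
    iso_mor a -> iso_mor b -> iso_mor c ->
    b ∘ f = f' ∘ a -> c ∘ g = g' ∘ b -> conflation f g -> conflation f' g';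
  inflation_id : forall X : E, inflation (idm X);
  deflation_id : forall X : E, deflation (idm X);
  inflation_comp : forall (X Y Z : E) (f : hom X Y) (g : hom Y Z),
    inflation f -> inflation g -> inflation (g ∘ f);
  deflation_comp : forall (X Y Z : E) (f : hom X Y) (g : hom Y Z),
    deflation f -> deflation g -> deflation (g ∘ f);
  inflation_pushout : forall (A B A' : E) (i : hom A B) (f : hom A A'),
    inflation i ->
    exists B' (i' : hom A' B') (f' : hom B B'),
      pushout i f i' f' /\ inflation i';
  deflation_pullback : forall (B C C' : E) (p : hom B C) (f : hom C' C),
    deflation p ->
    exists B' (p' : hom B' C') (f' : hom B' B),
      pullback p f p' f' /\ deflation p'
}.

Definition projective_obj (P : E) : Prop :=
  forall (Y Z : E) (p : hom Y Z), deflation p ->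
  forall f : hom P Z, exists g : hom P Y, p ∘ g = f.

Definition injective_obj (I : E) : Prop :=
  forall (X Y : E) (i : hom X Y), inflation i ->
  forall f : hom X I, exists g : hom Y I, g ∘ i = f.

Definition indecomposable (X : E) : Prop :=
  ~ zero_obj X /\ forall A B : E, biproduct A B X -> zero_obj A \/ zero_obj B.

Definition simple_obj (X : E) : Prop :=
  ~ zero_obj X /\
  ~ exists (L N : E) (i : hom L X) (p : hom X N),
      [/\ conflation i p, ~ zero_obj L & ~ zero_obj N].

(* The type of isomorphism classes of the objects satisfying P, each class
   being the predicate of being isomorphic to a given object. *)
Definition iso_class (P : E -> Prop) : Type :=
  {C : E -> Prop | exists2 X : E, P X & C = isomorphic X}.

(* Cardinalities of sets of isomorphism classes agree.  MathComp-Classical's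
   [card_eq] cannot be used: its universe is too small for the objects of a
   category of all [lmodType]s. *)
Definition same_number_of_iso_classes (P Q : E -> Prop) : Prop :=
  exists f : iso_class P -> iso_class Q, bijective f.

(* An element of the poset P(X) is represented by an inflation into X;
   [sub_eq] is equality in P(X). *)
Record subobj (X : E) := Subobj {
  sub_src :> E;
  sub_map : hom sub_src X;
  sub_mapP : inflation sub_map
}.

Section AdmissibleSubobjects.
Variable X : E.
Implicit Types A B : subobj X.

Definition sub_eq A B : Prop :=
  exists2 f : hom A B, iso_mor f & sub_map B ∘ f = sub_map A.

Definition sub_le A B : Prop :=
  exists2 f : hom A B, inflation f & sub_map B ∘ f = sub_map A.

Definition sub_lt A B : Prop := sub_le A B /\ ~ sub_eq A B.

(* Q is (a representative of) the quotient B/A. *)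
Definition sub_quotient A B (Q : E) : Prop :=
  exists (f : hom A B) (p : hom B Q),
    sub_map B ∘ f = sub_map A /\ conflation f p.

(* c 0 < ... < c n is a maximal chain in P(X) from 0 to X; the values c i for
   i > n are irrelevant. *)
Definition composition_series (n : nat) (c : nat -> subobj X) : Prop :=
  [/\ zero_obj (c 0%N),
      iso_mor (sub_map (c n)),
      forall i, (i < n)%N -> sub_lt (c i) (c i.+1) &
      forall B, (forall i, (i <= n)%N -> sub_le B (c i) \/ sub_le (c i) B) ->
        exists2 i, (i <= n)%N & sub_eq B (c i)].

Definition series_iso n (c : nat -> subobj X) m (d : nat -> subobj X) : Prop :=
  m = n /\
  exists s : 'S_n, forall i : 'I_n, exists Q Q' : E,
    [/\ sub_quotient (c i) (c i.+1) Q,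
        sub_quotient (d (s i)) (d (s i).+1) Q' & isomorphic Q Q'].

End AdmissibleSubobjects.

Definition JHP : Prop :=
  forall (X : E) n m (c d : nat -> subobj X),
    composition_series n c -> composition_series m d -> series_iso n c m d.

End ExactCategories.

Record exact_category := ExactCategory {
  ec_carrier :> preexact;
  ec_exact : is_exact ec_carrier
}.

Record exact_functor (C D : preexact) := ExactFunctor {
  fobj :> C -> D;
  fmor : forall X Y, hom X Y -> hom (fobj X) (fobj Y);
  fmor_id : forall X, fmor (idm X) = idm (fobj X);
  fmor_comp : forall X Y Z (g : hom Y Z) (f : hom X Y),
    fmor (g ∘ f) = fmor g ∘ fmor f;
  fmorD : forall X Y (f g : hom X Y), fmor (f + g) = fmor f + fmor g;
  fmor_conflation : forall X Y Z (f : hom X Y) (g : hom Y Z),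
    conflation f g -> conflation (fmor f) (fmor g)
}.

(* The functor G after F is naturally isomorphic to the identity. *)
Definition comp_iso_id (C D : preexact)
    (F : exact_functor C D) (G : exact_functor D C) : Prop :=
  exists eta : forall X : C, hom (G (F X)) X,
    (forall X, iso_mor (eta X)) /\
    forall (X Y : C) (f : hom X Y), f ∘ eta X = eta Y ∘ fmor G (fmor F f).

Definition exact_equivalent (C D : preexact) : Prop :=
  exists (F : exact_functor C D) (G : exact_functor D C),
    comp_iso_id F G /\ comp_iso_id G F.

Section FullSubcategory.
Variables (C : preexact) (P : C -> Prop).

Definition full_subcat : preexact :=
  @Preexact {X : C | P X} (fun X Y => hom (sval X) (sval Y))
    (fun X => idm (sval X)) (fun X Y Z g f => g ∘ f)
    (fun _ _ _ _ => @compA C _ _ _ _) (fun _ _ => @comp1m C _ _)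
    (fun _ _ => @compm1 C _ _) (fun _ _ _ => @compDl C _ _ _)
    (fun _ _ _ => @compDr C _ _ _)
    (fun X Y Z f g => conflation f g).

End FullSubcategory.

Definition is_ideal (R : comPzRingType) (I : set R) : Prop :=
  [/\ I 0, forall x y, I x -> I y -> I (x + y) &
      forall a x, I x -> I (a * x)].

Definition artinian (R : comPzRingType) : Prop :=
  forall I : nat -> set R,
    (forall n, is_ideal (I n)) -> (forall n, I n.+1 `<=` I n) ->
    exists n, forall m, (n <= m)%N -> I m = I n.

(* An R-algebra is given by a ring morphism phi from R to the centre of L;
   MathComp's [algType] is not used because it excludes the zero algebra. *)
Definition artin_algebra (R : comPzRingType) (L : pzRingType)
    (phi : {rmorphism R -> L}) : Prop :=
  [/\ artinian R,
      forall a x, phi a * x = x * phi a &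
      exists n (g : 'I_n -> L),
        forall x, exists a : 'I_n -> R, x = \sum_i phi (a i) * g i].

Section LinearMaps.
Variables (S : pzRingType) (M N : lmodType S).

Definition lhom : Type := {linear M -> N}.

HB.instance Definition _ := gen_eqMixin lhom.
HB.instance Definition _ := gen_choiceMixin lhom.

Lemma lhomP (f g : lhom) : (f : M -> N) =1 g -> f = g.
Proof.
case: f => f [[Df] [Zf]]; case: g => g [[Dg] [Zg]] /= /funext fg.
by subst g; congr GRing.Linear.Pack; congr GRing.Linear.Class;
  [congr GRing.isNmodMorphism.Axioms_ | congr GRing.isScalable.Axioms_];
  apply: Prop_irrelevance.
Qed.

Definition lhom_zero : lhom := \0.
Definition lhom_opp (f : lhom) : lhom := \- f.
Definition lhom_add (f g : lhom) : lhom := f \+ g.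

Fact lhom_addA : associative lhom_add.
Proof. by move=> f g h; apply: lhomP => x /=; rewrite addrA. Qed.
Fact lhom_addC : commutative lhom_add.
Proof. by move=> f g; apply: lhomP => x /=; rewrite addrC. Qed.
Fact lhom_add0 : left_id lhom_zero lhom_add.
Proof. by move=> f; apply: lhomP => x /=; rewrite add0r. Qed.
Fact lhom_addN : left_inverse lhom_zero lhom_opp lhom_add.
Proof. by move=> f; apply: lhomP => x /=; rewrite addNr. Qed.

HB.instance Definition _ :=
  GRing.isZmodule.Build lhom lhom_addA lhom_addC lhom_add0 lhom_addN.

End LinearMaps.

(* Right L-modules are left modules over the converse ring L^c. *)
Section ModuleCategory.
Variable L : pzRingType.

Definition fin_gen (M : lmodType L^c) : Prop :=
  exists n (g : 'I_n -> M),
    forall x, exists a : 'I_n -> L^c, x = \sum_i a i *: g i.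

Record fgmod := FGMod { fgmod_sort :> lmodType L^c; fgmodP : fin_gen fgmod_sort }.

Definition mod_id (M : fgmod) : lhom M M := idfun.
Definition mod_comp (M N P : fgmod) (g : lhom N P) (f : lhom M N) : lhom M P :=
  (g : {linear N -> P}) \o (f : {linear M -> N}).

Definition exact_at (M N P : lmodType L^c) (f : lhom M N) (g : lhom N P) : Prop :=
  forall y, (g : {linear N -> P}) y = 0 <->
            exists x, (f : {linear M -> N}) x = y.

Definition inj_map (M N : lmodType L^c) (f : lhom M N) : Prop :=
  injective (f : {linear M -> N}).

Definition surj_map (M N : lmodType L^c) (f : lhom M N) : Prop :=
  forall y, exists x, (f : {linear M -> N}) x = y.

Definition short_exact (M N P : fgmod) (f : lhom M N) (g : lhom N P) : Prop :=
  [/\ inj_map f, exact_at f g & surj_map g].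

Fact mod_compA (M N P Q : fgmod) (h : lhom P Q) (g : lhom N P) (f : lhom M N) :
  mod_comp h (mod_comp g f) = mod_comp (mod_comp h g) f.
Proof. exact: lhomP. Qed.

Fact mod_comp1m (M N : fgmod) (f : lhom M N) : mod_comp (mod_id N) f = f.
Proof. exact: lhomP. Qed.

Fact mod_compm1 (M N : fgmod) (f : lhom M N) : mod_comp f (mod_id M) = f.
Proof. exact: lhomP. Qed.

Fact mod_compDl (M N P : fgmod) (g g' : lhom N P) (f : lhom M N) :
  mod_comp (g + g') f = mod_comp g f + mod_comp g' f.
Proof. exact: lhomP. Qed.

Fact mod_compDr (M N P : fgmod) (g : lhom N P) (f f' : lhom M N) :
  mod_comp g (f + f') = mod_comp g f + mod_comp g f'.
Proof. by apply: lhomP => x /=; rewrite raddfD. Qed.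

Definition modc : preexact :=
  @Preexact fgmod (fun M N => lhom M N) mod_id mod_comp mod_compA mod_comp1m
    mod_compm1 mod_compDl mod_compDr short_exact.

(* ... -> P 1 -> P 0 -> X -> 0 *)
Record proj_resolution (X : modc) := ProjResolution {
  pr_obj :> nat -> modc;
  pr_diff : forall n, hom (pr_obj n.+1) (pr_obj n);
  pr_aug : hom (pr_obj 0%N) X;
  pr_projective : forall n, projective_obj (pr_obj n);
  pr_aug_surj : surj_map pr_aug;
  pr_exact0 : exact_at (pr_diff 0%N) pr_aug;
  pr_exactS : forall n, exact_at (pr_diff n.+1) (pr_diff n)
}.

(* 0 -> X -> I 0 -> I 1 -> ... *)
Record inj_resolution (X : modc) := InjResolution {
  ir_obj :> nat -> modc;
  ir_diff : forall n, hom (ir_obj n) (ir_obj n.+1);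
  ir_aug : hom X (ir_obj 0%N);
  ir_injective : forall n, injective_obj (ir_obj n);
  ir_aug_inj : inj_map ir_aug;
  ir_exact0 : exact_at ir_aug (ir_diff 0%N);
  ir_exactS : forall n, exact_at (ir_diff n) (ir_diff n.+1)
}.

Definition finite_injdim (X : modc) : Prop :=
  exists (I : inj_resolution X) (n : nat), forall j, (n < j)%N -> zero_obj (I j).

(* Cocycles and coboundaries of the complex Hom(P, U), whose cohomology in
   degree i is Ext^i(X, U). *)
Definition Ext_cocycle (X U : modc) (P : proj_resolution X) (i : nat)
    (f : hom (P i) U) : Prop :=
  f ∘ pr_diff P i = 0.

Definition Ext_coboundary (X U : modc) (P : proj_resolution X) (i : nat) :
    hom (P i) U -> Prop :=
  match i with
  | 0%N => fun f => f = 0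
  | j.+1 => fun f => exists g : hom (P j) U, f = g ∘ pr_diff P j
  end.

(* Ext^i(X, U) = 0.  Ext does not depend on the projective resolution it is
   computed from, so that it is enough to exhibit one. *)
Definition Ext_vanishes (i : nat) (X U : modc) : Prop :=
  exists P : proj_resolution X,
    forall f : hom (P i) U, Ext_cocycle f -> Ext_coboundary f.

Definition left_perp (U : modc) : preexact :=
  full_subcat (fun X : modc => forall i, (0 < i)%N -> Ext_vanishes i X U).

End ModuleCategory.

(* Main.v *)
From HB Require Import structures.
From mathcomp Require Import all_boot all_order all_algebra perm.
From mathcomp Require Import boolp classical_sets.
Require Import Defs.

(** The Grothendieck group of mod Λ is free on the simple modules, which are as
    many as the indecomposable projectives: each of these has a unique simple
    quotient. As U has finite injective dimension, every module is resolved by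
    objects of ⊥U in finitely many steps, so an additive function on ⊥U extends
    uniquely to mod Λ, and dimension vectors of objects of ⊥U span those of all
    modules. If (JHP) holds, the multiplicity of each simple object of ⊥U is an
    additive function; hence the dimension vectors of the simple objects are
    linearly independent, and as they also span there are as many of them as
    indecomposable projectives. Conversely, if the numbers agree, the dimension
    vectors of the simple objects are a spanning family of the right size, hence
    independent, and they determine the multiplicities of a composition series. *)

Set Implicit Arguments.
Unset Strict Implicit.
Unset Printing Implicit Defensive.

Import GRing.Theory Num.Theory.

Local Open Scope ring_scope.
Local Open Scope classical_set_scope.

(** * Submodules and quotients *)

(** No Grothendieck group is built: additive functions with values in a fixed group take its place,
    and [additive_expansion] plays the part of its freeness. The algebra enters only through the
    uniform chain bound [HL], derived from the finite length of a commutative artinian ring.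
    Multiplicities are counted by maps from a projective [P] along chains of submodules, so their
    additivity comes from projectivity and needs no Jordan-Hölder theorem for modules; only their
    positivity on matching simples is established, whence rational coefficients. Ext is given by
    projective resolutions, while the finiteness assumption concerns an injective one: [Ext_lifts]
    passes from one to the other, and then the classes of modules with Ext^j(-, U) = 0 for all j > k
    climb from ⊥U to all modules as k grows. A priori there may be infinitely many simple objects,
    so independence is shown for every finite family of them, and this bounds their number. *)

Section Submodules.
Variable S : pzRingType.
Implicit Types M N : lmodType S.

Definition submod M (A : set M) : Prop :=
  [/\ A 0, forall x y, A x -> A y -> A (x + y) & forall a x, A x -> A (a *: x)].

Lemma submodN M (A : set M) x : submod A -> A x -> A (- x).
Proof. by case=> _ _ h Ax; rewrite -scaleN1r; apply: h. Qed.

Lemma submodB M (A : set M) x y : submod A -> A x -> A y -> A (x - y).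
Proof. by move=> hA Ax Ay; case: (hA) => _ h _; apply: h => //; apply: submodN. Qed.

End Submodules.

Section SubmoduleType.
Variables (S : pzRingType) (M : lmodType S) (A : set M) (HA : submod A).

(** The closure proof is a parameter of the type, so that the module structure is inferred from the
    type. *)
Definition submod_type of submod A : Type := {x : M | `[< A x >]}.
Local Notation T := (submod_type HA).

HB.instance Definition _ := [isSub of T for @sval M _].
HB.instance Definition _ := [Choice of T by <:].

Fact submod_type_closed : GRing.submod_closed (fun x : M => `[< A x >]).
Proof.
case: HA => A0 AD AZ; split; first exact/asboolP.
by move=> a x y /asboolP Ax /asboolP Ay; apply/asboolP/AD => //; exact: AZ.
Qed.

HB.instance Definition _ :=
  GRing.SubChoice_isSubLmodule.Build S M _ T submod_type_closed.

End SubmoduleType.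

Lemma sub_exists (S : pzRingType) (M : lmodType S) (A : set M) : submod A ->
  exists (N : lmodType S) (i : {linear N -> M}),
    injective i /\ forall x, A x <-> exists y, i y = x.
Proof.
move=> HA; exists (submod_type HA : lmodType S).
exists (val : {linear submod_type HA -> M}); split; first exact: val_inj.
move=> x; split=> [Ax|[y <-]]; last exact/asboolP/(valP y).
by exists (exist (fun x => `[< A x >]) x (asboolT Ax)).
Qed.

Section QuotientType.
Variables (S : pzRingType) (M : lmodType S) (A : set M) (HA : submod A).

(** The quotient is realised on chosen coset representatives. [xget] depends only on the set it is
    given, so congruent elements receive the same representative, and the fixed points of
    [coset_repr] form a subtype that inherits a choice structure. *)
Definition coset_repr (x : M) : M := xget 0 (fun y : M => A (x - y)).

Fact coset_reprP x : A (x - coset_repr x).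
Proof.
apply: (@xgetPex _ _ (fun y : M => A (x - y))).
by exists x; rewrite subrr; case: HA.
Qed.

Fact coset_repr_eq x y : A (x - y) -> coset_repr x = coset_repr y.
Proof.
move=> Axy; congr (xget _ _); apply: funext => z; apply: propext.
have e : x - z = (x - y) + (y - z) by rewrite addrA subrK.
rewrite e; split=> Az; last by case: HA => _ AD _; apply: AD.
by rewrite -[y - z](addKr (x - y)) addrC; apply: submodB.
Qed.

Definition submod_quot of submod A : Type := {x : M | coset_repr x == x}.
Local Notation T := (submod_quot HA).

HB.instance Definition _ := [isSub of T for @sval M _].
HB.instance Definition _ := [Choice of T by <:].

Fact coset_repr_idem x : coset_repr (coset_repr x) == coset_repr x.
Proof.
by apply/eqP/coset_repr_eq; rewrite -opprB; apply: submodN (coset_reprP _).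
Qed.

Definition to_quot (x : M) : T :=
  exist (fun y => coset_repr y == y) _ (coset_repr_idem x).

Fact to_quotK : cancel (val : T -> M) to_quot.
Proof. by move=> x; apply: val_inj; apply/eqP/(valP x). Qed.

Fact to_quot_eq x y : (to_quot x = to_quot y) <-> A (x - y).
Proof.
split=> [/(congr1 val) /= e|/coset_repr_eq e]; last exact: val_inj.
rewrite -[x](subrK (coset_repr x)) -addrA {2}e.
case: (HA) => _ AD _; apply: AD (coset_reprP x) _.
by rewrite -opprB; apply: submodN (coset_reprP _).
Qed.

Fact to_quot_val x : A (val (to_quot x) - x).
Proof. by apply/to_quot_eq; rewrite to_quotK. Qed.

Definition quot_add (x y : T) : T := to_quot (val x + val y).
Definition quot_opp (x : T) : T := to_quot (- val x).
Definition quot_scale a (x : T) : T := to_quot (a *: val x).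

Fact quot_addE x y : quot_add (to_quot x) (to_quot y) = to_quot (x + y).
Proof.
apply/to_quot_eq; rewrite opprD addrACA.
by case: (HA) => _ AD _; apply: AD; apply: to_quot_val.
Qed.

Fact quot_oppE x : quot_opp (to_quot x) = to_quot (- x).
Proof. by apply/to_quot_eq; rewrite -opprD; apply: submodN (to_quot_val _). Qed.

Fact quot_scaleE a x : quot_scale a (to_quot x) = to_quot (a *: x).
Proof.
apply/to_quot_eq; rewrite -scalerBr.
by case: (HA) => _ _ AZ; apply: AZ; apply: to_quot_val.
Qed.

Fact quot_ind (P : T -> Prop) : (forall x, P (to_quot x)) -> forall x, P x.
Proof. by move=> h x; rewrite -(to_quotK x). Qed.

Fact quot_addA : associative quot_add.
Proof.
by elim/quot_ind=> x; elim/quot_ind=> y; elim/quot_ind=> z;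
  rewrite !quot_addE addrA.
Qed.
Fact quot_addC : commutative quot_add.
Proof. by move=> x y; rewrite /quot_add addrC. Qed.
Fact quot_add0 : left_id (to_quot 0) quot_add.
Proof. by elim/quot_ind=> x; rewrite quot_addE add0r. Qed.
Fact quot_addN : left_inverse (to_quot 0) quot_opp quot_add.
Proof. by elim/quot_ind=> x; rewrite quot_oppE quot_addE addNr. Qed.

HB.instance Definition _ :=
  GRing.isZmodule.Build T quot_addA quot_addC quot_add0 quot_addN.

Fact quot_scaleA a b v : quot_scale a (quot_scale b v) = quot_scale (a * b) v.
Proof. by elim/quot_ind: v => x; rewrite !quot_scaleE scalerA. Qed.
Fact quot_scale1 : left_id 1 quot_scale.
Proof. by elim/quot_ind=> x; rewrite quot_scaleE scale1r. Qed.
Fact quot_scaleDr : right_distributive quot_scale +%R.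
Proof.
move=> a; elim/quot_ind=> x; elim/quot_ind=> y.
by rewrite [X in quot_scale a X]quot_addE !quot_scaleE scalerDr -quot_addE.
Qed.
Fact quot_scaleDl v : {morph quot_scale^~ v : a b / a + b}.
Proof.
elim/quot_ind: v => x a b.
by rewrite /= !quot_scaleE scalerDl -quot_addE.
Qed.

HB.instance Definition _ := GRing.Zmodule_isLmodule.Build S T
  quot_scaleA quot_scale1 quot_scaleDr quot_scaleDl.

Fact to_quot_is_linear : linear (to_quot : M -> T).
Proof. by move=> a x y; rewrite -quot_addE -quot_scaleE. Qed.

HB.instance Definition _ :=
  GRing.isLinear.Build S M T *:%R to_quot to_quot_is_linear.

End QuotientType.

Lemma quot_exists (S : pzRingType) (M : lmodType S) (A : set M) : submod A ->
  exists (N : lmodType S) (p : {linear M -> N}),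
    (forall y, exists x, p x = y) /\ forall x, p x = 0 <-> A x.
Proof.
move=> HA; exists (submod_quot HA : lmodType S).
exists (@to_quot S M A HA : {linear M -> submod_quot HA}); split.
  by move=> y; exists (sval y); apply: to_quotK.
by move=> x; rewrite -[X in A X]subr0; apply: to_quot_eq.
Qed.

Section Factorization.
Variable S : pzRingType.

(** Working with the graph of a map lets the factorizations below define values through arbitrary
    preimages; uniqueness on the graph replaces well-definedness. *)
Lemma linear_exists (M N : lmodType S) (G : M -> N -> Prop) :
  (forall x, exists y, G x y) ->
  (forall x y y', G x y -> G x y' -> y = y') ->
  (forall a x x' y y', G x y -> G x' y' -> G (a *: x + x') (a *: y + y')) ->
  exists f : {linear M -> N}, forall x, G x (f x).
Proof.
move=> /choice[f fP] Guniq Glin.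
have lf : linear f by move=> a x y; apply: Guniq (fP _) _; apply: Glin.
pose F := GRing.isLinear.Build S M N *:%R f lf.
pose F' : {linear M -> N} := HB.pack f F.
by exists F'.
Qed.

Lemma factor_surj (M N K : lmodType S) (p : {linear M -> N})
    (f : {linear M -> K}) :
  (forall y, exists x, p x = y) -> (forall x, p x = 0 -> f x = 0) ->
  exists g : {linear N -> K}, forall x, g (p x) = f x.
Proof.
move=> surj ker.
have h x y : p x = p y -> f x = f y.
  move=> e; apply/eqP; rewrite -subr_eq0 -raddfB; apply/eqP/ker.
  by rewrite linearB /= e subrr.
have [||| g gP] := @linear_exists N K (fun y z => exists2 x, p x = y & f x = z).
- by move=> y; have [x <-] := surj y; exists (f x); exists x.
- by move=> y z z' [x <- <-] [x' /h e <-].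
- move=> a y y' z z' [x <- <-] [x' <- <-]; exists (a *: x + x'); by rewrite linearP.
by exists g => x; have [x' /h e <-] := gP (p x).
Qed.

Lemma factor_inj (M N K : lmodType S) (i : {linear N -> M})
    (f : {linear K -> M}) :
  injective i -> (forall x, exists y, i y = f x) ->
  exists g : {linear K -> N}, forall x, i (g x) = f x.
Proof.
move=> inj im.
have [||| g gP] := @linear_exists K N (fun x y => i y = f x) => //.
- by move=> x y y' <- /inj.
- by move=> a x x' y y' e e'; rewrite !linearP e e'.
by exists g.
Qed.

End Factorization.

(** * Modules over an artin algebra have bounded chains of submodules *)

(** Finite length as a uniform bound on the strict steps of an infinite ascending chain. Repetitions
    are allowed, so that intersections and images of a chain are again chains. *)
Definition bounded_chains (T : Type) (Q : set T -> Prop) : Prop :=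
  exists N, forall c : nat -> set T,
    (forall i, Q (c i)) -> (forall i, c i `<=` c i.+1) ->
    forall n, (\sum_(i < n) `[< c i <> c i.+1 >] <= N)%N.

Lemma bounded_chains_unit : bounded_chains (fun _ : set unit => True).
Proof.
exists 1%N => c _ cS n.
suff : (\sum_(i < n) `[< c i <> c i.+1 >] <= `[< c n tt >])%N.
  by move/leq_trans; apply; case: `[< _ >].
elim: n => [|n IH]; first by rewrite big_ord0.
rewrite big_ord_recr /=.
have [cn|ncn] := pselect (c n tt).
  have cn1 := cS n tt cn.
  have -> : `[< c n <> c n.+1 >] = false.
    by apply: asboolF; apply; apply/seteqP; split=> -[].
  rewrite addn0 (leq_trans IH) //.
  by rewrite (asboolT cn) (asboolT cn1).
move: IH; rewrite (asboolF ncn) leqn0 => /eqP ->; rewrite add0n.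
have [e|ne] := pselect (c n = c n.+1); first by rewrite asboolF //; apply.
suff /asboolT -> : c n.+1 tt by apply: leq_b1.
by apply: contrapT => ncn1; apply: ne; apply/seteqP; split=> -[].
Qed.

(** The pattern of a short exact sequence: [a] is the trace on a subobject and [b] the image in the
    quotient. The last hypothesis is the modular law: a strict step is strict for [a] or for [b], so
    the two bounds add up. *)
Lemma bounded_chains_comb (T T1 T2 : Type) (Q : set T -> Prop)
    (Q1 : set T1 -> Prop) (Q2 : set T2 -> Prop) a b :
  bounded_chains Q1 -> bounded_chains Q2 ->
  (forall A, Q A -> Q1 (a A)) -> (forall A, Q A -> Q2 (b A)) ->
  (forall A B, A `<=` B -> a A `<=` a B) ->
  (forall A B, A `<=` B -> b A `<=` b B) ->
  (forall A B, Q A -> Q B -> A `<=` B -> a A = a B -> b A = b B -> B `<=` A) ->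
  bounded_chains Q.
Proof.
move=> [N1 h1] [N2 h2] aQ bQ aS bS ab; exists (N1 + N2)%N => c cQ cS n.
apply: (@leq_trans (\sum_(i < n) `[< a (c i) <> a (c i.+1) >] +
                    \sum_(i < n) `[< b (c i) <> b (c i.+1) >])%N).
  rewrite -big_split; apply: leq_sum => i _ /=.
  have [e1|/asboolT -> ] := pselect (a (c i) = a (c i.+1)); last first.
    by rewrite (leq_trans (leq_b1 _)) // leq_addr.
  have [e2|/asboolT -> ] := pselect (b (c i) = b (c i.+1)); last first.
    by rewrite (leq_trans (leq_b1 _)) // leq_addl.
  rewrite asboolF //; apply; apply/seteqP; split; first exact: cS.
  exact: ab.
by apply: leq_add; [apply: (h1 (a \o c)) => i|apply: (h2 (b \o c)) => i] => /=; auto.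
Qed.

Section ArtinianRing.
Variables (R : comPzRingType) (HR : artinian R).
Implicit Types I J W : set R.

Let FL I : Prop := bounded_chains (fun J => is_ideal J /\ J `<=` I).

Lemma artinian_min (Pr : set R -> Prop) I0 : is_ideal I0 -> Pr I0 ->
  exists I, [/\ is_ideal I, Pr I & forall J, is_ideal J -> J `<=` I -> Pr J -> J = I].
Proof.
move=> iI0 PI0; apply: contrapT => noI.
have /choice[f fP] : forall K : {I | is_ideal I /\ Pr I},
    exists K' : {I | is_ideal I /\ Pr I}, sval K' `<=` sval K /\ sval K' <> sval K.
  move=> [I [iI PI]] /=; apply: contrapT => noK; apply: noI.
  exists I; split=> // J iJ JI PJ; apply: contrapT => nJI; apply: noK.
  by exists (exist _ J (conj iJ PJ)).
pose c n := iter n f (exist _ I0 (conj iI0 PI0)).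
have [|n|n cn] := HR (I := fun n => sval (c n)).
- by move=> n; case: (c n) => I [].
- by have [] := fP (c n).
have [_] := fP (c n); apply.
by rewrite -(cn n.+1).
Qed.

Lemma ideal_setI I J : is_ideal I -> is_ideal J -> is_ideal (I `&` J).
Proof.
move=> [I0 ID IM] [J0 JD JM]; split=> //.
- by move=> x y [? ?] [? ?]; split; [apply: ID|apply: JD].
- by move=> a x [? ?]; split; [apply: IM|apply: JM].
Qed.

Lemma idealB I x y : is_ideal I -> I x -> I y -> I (x - y).
Proof.
by move=> [_ ID IM] Ix Iy; apply: ID => //; rewrite -mulN1r; apply: IM.
Qed.

Lemma ideal_mulset I a : is_ideal I -> is_ideal [set a * x | x in I].
Proof.
move=> [I0 ID IM]; split; first by exists 0; rewrite ?mulr0.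
- by move=> _ _ [x Ix <-] [y Iy <-]; exists (x + y); [apply: ID|rewrite mulrDr].
- by move=> b _ [x Ix <-]; exists (b * x); [apply: IM|rewrite mulrCA].
Qed.

(* Each a in R has aI = 0 or aI = I, so R / Ann I is a field and I a vector space
   over it: a hyperplane W of I has bounded chains, hence so does I. *)
Section MinimalBad.
Variable I : set R.
Hypotheses (iI : is_ideal I) (badI : ~ FL I).
Hypothesis minI : forall J, is_ideal J -> J `<=` I -> J <> I -> FL J.

(** If the kernel of multiplication by [a] on I and its image aI were both proper in I, both would
    have bounded chains by minimality, and then so would I. *)
Lemma bad_mul a : (forall x, I x -> a * x = 0) \/ [set a * x | x in I] = I.
Proof.
case: (iI) => I0 ID IM.
pose K := I `&` [set x | a * x = 0].
have iK : is_ideal K.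
  apply: ideal_setI => //; split=> /=; first by rewrite mulr0.
  - by move=> x y; rewrite mulrDr => -> ->; rewrite addr0.
  - by move=> b x ax; rewrite mulrCA ax mulr0.
have [eK|nK] := pselect (K = I); first by left=> x; rewrite -eK => -[].
right; apply: contrapT => naI; apply: badI.
have FLK : FL K by apply: minI => // x [].
have FLa : FL [set a * x | x in I].
  by apply: minI naI; [apply: ideal_mulset|move=> _ [x Ix <-]; apply: IM].
apply: (bounded_chains_comb (a := fun J => J `&` K)
  (b := fun J => [set a * x | x in J]) FLK FLa).
- by move=> J [iJ _]; split; [apply: ideal_setI|move=> x []].
- move=> J [iJ JI]; split; first exact: ideal_mulset.
  by move=> _ [x Jx <-]; exists x => //; apply: JI.
- by move=> A B AB x [/AB].
- by move=> A B AB _ [x /AB Bx <-]; exists x.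
move=> A B [iA AI] [iB BI] AB e1 e2 x Bx.
have : [set a * x | x in A] (a * x) by rewrite e2; exists x.
move=> [y Ay eyx].
have : (B `&` K) (x - y).
  split; first by apply: idealB => //; apply: AB.
  split; last by rewrite /= mulrBr eyx subrr.
  by apply: idealB => //; [apply: BI|apply: AI].
rewrite -e1 => -[Axy _]; rewrite -(subrK y x).
by case: iA => _ AD _; apply: AD.
Qed.

(** The descending chain of the principal ideals of the powers of [a] stabilises, so a^n = r a^(n+1)
    for some r. As aI = I gives a^n I = I, the element 1 - ra annihilates I. *)
Lemma bad_inv a : ~ (forall x, I x -> a * x = 0) ->
  exists r, forall x, I x -> r * (a * x) = x.
Proof.
move=> na; case: (iI) => I0 ID IM.
have {na}aI : [set a * x | x in I] = I by case: (bad_mul a).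
pose c n : set R := [set x | exists r, x = r * a ^+ n].
have [n|n|n cn] := HR (I := c).
- split; first by exists 0; rewrite mul0r.
  + by move=> _ _ [r ->] [s ->]; exists (r + s); rewrite mulrDl.
  + by move=> b _ [r ->]; exists (b * r); rewrite mulrA.
- by move=> x [r ->]; exists (r * a); rewrite exprS mulrA.
have : c n.+1 (a ^+ n) by rewrite (cn n.+1) //; exists 1; rewrite mul1r.
move=> [r er]; exists r => x Ix; apply/eqP; rewrite eq_sym -subr_eq0; apply/eqP.
have e0 y : (1 - r * a) * a ^+ n * y = 0.
  by rewrite mulrBl mul1r -mulrA -exprS -er subrr mul0r.
have anI m : [set a ^+ m * x | x in I] = I.
  elim: m => [|m IH].
    by apply/seteqP; split=> [_ [y Iy <-]|y Iy]; rewrite ?mul1r //; exists y; rewrite ?mul1r.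
  apply/seteqP; split=> [_ [y Iy <-]|]; first exact: IM.
  rewrite -{1}IH => _ [y Iy <-].
  by move: Iy; rewrite -{1}aI => -[z Iz <-]; exists z; rewrite // exprSr mulrA.
move: Ix; rewrite -{1}(anI n) => -[y _ <-].
by have := e0 y; rewrite mulrBl mul1r mulrBl !mulrA.
Qed.

Lemma bad_false : False.
Proof.
case: (iI) => I0 ID IM.
have [x Ix xn0] : exists2 x, I x & x <> 0.
  apply: contrapT => noI; apply: badI; exists 0%N => c cI cS n.
  rewrite big1 // => i _; rewrite asboolF //; apply.
  suff h j : c j = [set 0] by rewrite !h.
  have [[c0 _ _] cj] := cI j.
  apply/seteqP; split=> [y /cj Iy|y ->//].
  by apply: contrapT => y0; apply: noI; exists y.
(* Zorn's lemma is applied to subsets avoiding a nonzero [x]. Membership of 0 is left out of [PW],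
   as the union of the empty chain is empty; it is recovered from maximality. *)
pose PW W := [/\ forall y z, W y -> W z -> W (y + z), forall a y, W y -> W (a * y),
  W `<=` I & ~ W x].
have [F FP Ftot|W [[WD WM WI nWx] maxW]] := @Zorn_bigcup _ PW.
  split.
  - move=> y z [A FA Ay] [B FB Bz].
    have [AB|BA] := Ftot _ _ FA FB.
      by exists B => //; have [BD _ _ _] := FP _ FB; apply: BD => //; apply: AB.
    by exists A => //; have [AD _ _ _] := FP _ FA; apply: AD => //; apply: BA.
  - by move=> a y [A FA Ay]; exists A => //; have [_ AM _ _] := FP _ FA; apply: AM.
  - by move=> y [A FA Ay]; have [_ _ AI _] := FP _ FA; apply: AI.
  - by move=> [A FA Ay]; have [_ _ _] := FP _ FA; apply.
have W0 : W 0.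
  apply: contrapT => W0.
  have noW z : ~ W z by move=> /(WM 0); rewrite mul0r.
  apply: (maxW [set 0]).
    by split=> [z /noW //|sub]; apply: W0; apply: sub.
  by split=> [_ _ -> ->|b _ ->|_ ->|/esym]; rewrite ?addr0 ?mulr0 // => /esym.
(* Otherwise W + Ry would be a larger set still avoiding [x]. *)
have spanx y : I y -> ~ W y -> exists w a, W w /\ x = w + a * y.
  move=> Iy nWy; apply: contrapT => nox.
  apply: (maxW [set z | exists w a, (W w \/ w = 0) /\ z = w + a * y]).
    split=> [z Wz|sub]; first by exists z, 0; split; [left|rewrite mul0r addr0].
    by apply: nWy; apply: sub; exists 0, 1; split; [right|rewrite mul1r add0r].
  split.
  - move=> _ _ [w [a [Ww ->]]] [w' [a' [Ww' ->]]]; exists (w + w'), (a + a').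
    split; last by rewrite mulrDl addrACA.
    case: Ww Ww' => [Ww|->] [Ww'|->]; rewrite ?addr0 ?add0r;
      by [right|left => //; apply: WD].
  - move=> b _ [w [a [Ww ->]]]; exists (b * w), (b * a);
    split; last by rewrite mulrDr mulrA.
    by case: Ww => [/WM|->]; [left|right; rewrite mulr0].
  - move=> _ [w [a [Ww ->]]]; apply: ID; last exact: IM.
    by case: Ww => [/WI|->].
  - move=> [w [a [[Ww|->] ex]]]; first by apply: nox; exists w, a.
    by apply: nox; exists 0, a.
have iW : is_ideal W by split.
(* For z outside W, write x = w + ay = w' + bz. Since x is outside W, [b] does not annihilate I, so
   it has an inverse [r] on I and the equation can be solved for z. *)
have spanI y z : I y -> I z -> ~ W y -> exists w a, W w /\ z = w + a * y.
  move=> Iy Iz nWy.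
  have [w [a [Ww ex]]] := spanx y Iy nWy.
  have [Wz|nWz] := pselect (W z); first by exists z, 0; rewrite mul0r addr0.
  have [w' [b [Ww' ex']]] := spanx z Iz nWz.
  have [|r rP] := @bad_inv b.
    by move=> h; apply: nWx; rewrite ex' (h z Iz) addr0.
  exists (r * (w - w')), (r * a); split; first by apply: WM; apply: idealB.
  rewrite -{1}(rP z Iz) -mulrA -mulrDr; congr (_ * _).
  have : w' + b * z = w + a * y by rewrite -ex -ex'.
  by move/(congr1 (+%R^~ (- w'))); rewrite /= addrAC subrr add0r => ->; rewrite addrAC.
apply: badI.
(* W is a hyperplane of I: along a chain, an ideal changes only if its trace on W changes or it
   ceases to lie in W. The subset of [unit] records the second event, which happens at most once. *)
apply: (@bounded_chains_comb _ _ _ _ _ _ (fun J => J `&` W)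
  (fun J => [set _ : unit | ~ J `<=` W]) (minI iW WI _) bounded_chains_unit) => //.
- by move=> eWI; apply: nWx; rewrite eWI.
- by move=> J [iJ JI]; split; [apply: ideal_setI|move=> y []].
- by move=> A B AB y [/AB].
- by move=> A B AB y /= nA BW; apply: nA => z /AB /BW.
move=> A B [iA AI] [iB BI] AB eW eT z Bz.
have [Wz|nWz] := pselect (W z).
  by have : (B `&` W) z by []; rewrite -eW => -[].
have : [set _ : unit | ~ B `<=` W] tt by move=> /(_ z Bz).
rewrite -eT /= => nAW.
have [y Ay nWy] : exists2 y, A y & ~ W y.
  apply: contrapT => noy; apply: nAW => y Ay; apply: contrapT => nWy.
  by apply: noy; exists y.
have [w [a [Ww ez]]] := spanI y z (AI _ Ay) (BI _ Bz) nWy.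
case: (iA) => _ AD AM; case: (iB) => _ BD BM.
rewrite ez; apply: AD; last exact: AM.
suff : (B `&` W) w by rewrite -eW => -[].
split=> //; have -> : w = z - a * y by rewrite ez addrK.
by apply: idealB => //; apply: BM; apply: AB.
Qed.

End MinimalBad.

(** If the unit ideal were bad, the descending chain condition would give a minimal bad ideal, which
    [bad_false] excludes. *)
Lemma artinian_bounded_chains : bounded_chains (@is_ideal R).
Proof.
have iT : is_ideal [set: R] by split.
suff [N h] : FL setT by exists N => c ci; apply: h => i; split.
apply: contrapT => bad.
have [I [iI badI minI]] := artinian_min (Pr := fun I => ~ FL I) iT bad.
apply: (bad_false iI badI) => J iJ JI nJI.
by apply: contrapT => badJ; apply: nJI; apply: minI.
Qed.

End ArtinianRing.

Section ArtinAlgebra.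
Variables (R : comPzRingType) (L : pzRingType) (phi : {rmorphism R -> L}).
Hypothesis HL : artin_algebra phi.

Section CoefficientSpan.
Variable M : lmodType L^c.

Let act (r : R) (x : M) : M := (phi r : L^c) *: x.

Let actM r s x : act (r * s) x = act r (act s x).
Proof.
have [_ cent _] := HL; rewrite /act scalerA rmorphM; congr (_ *: _).
exact: cent.
Qed.

Let actDl r s x : act (r + s) x = act r x + act s x.
Proof. by rewrite /act rmorphD; apply: (scalerDl x (phi r : L^c) (phi s)). Qed.

Let actDr r x y : act r (x + y) = act r x + act r y.
Proof. by rewrite /act scalerDr. Qed.

Let act0 x : act 0 x = 0.
Proof. by rewrite /act rmorph0; apply: (scale0r x). Qed.

Let act1 x : act 1 x = x.
Proof. by rewrite /act rmorph1; apply: (scale1r x). Qed.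

Let actN r x : act (- r) x = - act r x.
Proof. by rewrite /act rmorphN; apply: (scaleNr (phi r : L^c) x). Qed.

Definition coef_submod (A : set M) : Prop :=
  [/\ A 0, forall x y, A x -> A y -> A (x + y) & forall r x, A x -> A (act r x)].

Fixpoint coef_span (gs : seq M) : set M :=
  if gs is g :: gs' then [set x | exists r s, coef_span gs' s /\ x = act r g + s]
  else [set 0].

Lemma coef_submodB A x y : coef_submod A -> A x -> A y -> A (x - y).
Proof.
move=> [_ AD AZ] Ax Ay; apply: AD => //.
by have := AZ (-1) y Ay; rewrite actN act1.
Qed.

Lemma coef_span_submod gs : coef_submod (coef_span gs).
Proof.
elim: gs => [|g gs [IH0 IHD IHZ]].
  by split=> [//|_ _ -> ->|r _ ->] /=; rewrite ?addr0 // /act scaler0.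
split.
- by exists 0, 0; split=> //; rewrite act0 addr0.
- move=> _ _ [r [s [hs ->]]] [r' [s' [hs' ->]]]; exists (r + r'), (s + s').
  by split; [apply: IHD|rewrite actDl addrACA].
- move=> a _ [r [s [hs ->]]]; exists (a * r), (act a s).
  by split; [apply: IHZ|rewrite actDr actM].
Qed.

(** Adjoining [g] extends the span by a cyclic R-module. The image of [A] in it is recorded by the
    ideal of those r with r g + s in A for some s in the span of [gs], and chains of ideals of R are
    bounded. *)
Lemma coef_span_bounded gs :
  bounded_chains (fun A => coef_submod A /\ A `<=` coef_span gs).
Proof.
have [artR _ _] := HL.
elim: gs => [|g gs IH].
  exists 0%N => c cA cS n; rewrite big1 // => i _; rewrite asboolF //; apply.
  suff h j : c j = [set 0] by rewrite !h.
  have [[c0 _ _] cj] := cA j.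
  by apply/seteqP; split=> [y /cj|y ->//].
apply: (bounded_chains_comb (a := fun A => A `&` coef_span gs)
  (b := fun A => [set r | exists2 s, coef_span gs s & A (act r g + s)])
  IH (artinian_bounded_chains artR)).
- move=> A [[A0 AD AZ] _]; have [S0 SD SZ] := coef_span_submod gs; split.
    split; first by [].
      by move=> x y [Ax Sx] [Ay Sy]; split; [apply: AD|apply: SD].
    by move=> r x [Ax Sx]; split; [apply: AZ|apply: SZ].
  by move=> x [].
- move=> A [[A0 AD AZ] _]; have [S0 SD SZ] := coef_span_submod gs; split.
  + by exists 0; rewrite // act0 addr0.
  + move=> r r' [s hs As] [s' hs' As']; exists (s + s'); first exact: SD.
    by rewrite actDl addrACA; apply: AD.
  + move=> a r [s hs As]; exists (act a s); first exact: SZ.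
    by rewrite actM -actDr; apply: AZ.
- by move=> A B AB x [/AB].
- by move=> A B AB r [s hs /AB Bs]; exists s.
move=> A B [sA AS] [sB BS] AB e1 e2 x Bx.
have [r [s [hs ex]]] := BS x Bx.
have : [set r | exists2 s, coef_span gs s & B (act r g + s)] r by exists s; rewrite -?ex.
rewrite -e2 => -[s' hs' As'].
have : (B `&` coef_span gs) (s - s').
  split; last exact: coef_submodB (coef_span_submod gs) _ _.
  have -> : s - s' = x - (act r g + s') by rewrite ex opprD addrACA subrr add0r.
  exact: coef_submodB (AB _ As').
rewrite -e1 => -[As _].
have -> : x = (act r g + s') + (s - s') by rewrite ex addrA addrAC addrK.
by case: sA => _ AD _; apply: AD.
Qed.

Lemma coef_span_mem gs x : x \in gs -> coef_span gs x.
Proof.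
elim: gs => // g gs IH; rewrite inE => /orP[/eqP ->|/IH h].
  exists 1, 0; rewrite act1 addr0; split=> //.
  by case: (coef_span_submod gs).
by exists 0, x; rewrite act0 add0r.
Qed.

(** Generators of M over L times generators of L over R generate M over R, and every L-submodule is
    an R-submodule. *)
Lemma fin_gen_bounded : fin_gen M -> bounded_chains (@submod _ M).
Proof.
have [_ cent [k [h hP]]] := HL.
move=> [n [g gP]].
pose gs := [seq (h j : L^c) *: g i | i <- enum 'I_n, j <- enum 'I_k].
have [N hN] := coef_span_bounded gs.
exists N => c cA; apply: hN => i; have [c0 cD cZ] := cA i; split.
  by split=> // r x; apply: cZ.
move=> x _; have [a ->] := gP x.
have sg := coef_span_submod gs; case: (sg) => S0 SD SZ.
apply: big_rec => // j y _ Sy; apply: (SD) => //.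
have [b ->] := hP (a j).
have -> : (\sum_i phi (b i) * h i : L^c) *: g j = \sum_i (phi (b i) * h i : L^c) *: g j.
  by apply: (@scaler_suml L^c M).
apply: big_rec => // l z _ Sz; apply: SD => //.
have -> : (phi (b l) * h l : L^c) *: g j = act (b l) ((h l : L^c) *: g j).
  rewrite /act scalerA; congr (_ *: _); exact: cent.
by apply: SZ; apply: coef_span_mem; apply: allpairs_f; rewrite mem_enum.
Qed.

End CoefficientSpan.
End ArtinAlgebra.

(** * Finitely generated modules *)

Section FinGen.
Variable L : pzRingType.
Hypothesis HL : forall M : lmodType L^c, fin_gen M -> bounded_chains (@submod _ M).

Fixpoint lspan (M : lmodType L^c) (gs : seq M) : set M :=
  if gs is g :: gs' then [set x | exists r s, lspan gs' s /\ x = r *: g + s]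
  else [set 0].

Lemma lspan_submod (M : lmodType L^c) (gs : seq M) : submod (lspan gs).
Proof.
elim: gs => [|g gs [IH0 IHD IHZ]].
  by split=> [//|_ _ -> ->|r _ ->] /=; rewrite ?addr0 // scaler0.
split.
- by exists 0, 0; split=> //; rewrite scale0r addr0.
- move=> _ _ [r [s [hs ->]]] [r' [s' [hs' ->]]]; exists (r + r'), (s + s').
  by split; [apply: IHD|rewrite scalerDl addrACA].
- move=> a _ [r [s [hs ->]]]; exists (a * r), (a *: s).
  by split; [apply: IHZ|rewrite scalerDr scalerA].
Qed.

Lemma lspan_gen (M : lmodType L^c) (gs : seq M) x : lspan gs x ->
  exists a : 'I_(size gs) -> L^c, x = \sum_i a i *: nth 0 gs i.
Proof.
elim: gs x => [|g gs IH] x /=.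
  by move=> ->; exists (fun=> 0); rewrite big_ord0.
move=> [r [s [/IH[a ->] ->]]].
exists (fun i => oapp a r (unlift ord0 i)).
rewrite big_ord_recl unlift_none /=; congr (_ + _).
by apply: eq_bigr => i _; rewrite liftK.
Qed.

(** Otherwise adjoining, again and again, a vector outside the span so far gives a chain with more
    strict steps than the bound. *)
Lemma bounded_fin_gen (M : lmodType L^c) :
  bounded_chains (@submod _ M) -> fin_gen M.
Proof.
move=> [N hN]; apply: contrapT => nfg.
have next (gs : seq M) : exists x, ~ lspan gs x.
  apply: contrapT => nx; apply: nfg; exists (size gs), (fun i => nth 0 gs i) => x.
  by apply: lspan_gen; apply: contrapT => nsx; apply: nx; exists x.
have [f fP] := choice next.
pose c n := iter n (fun gs => f gs :: gs) [::].
have : (\sum_(i < N.+1) `[< lspan (c i) <> lspan (c i.+1) >] <= N)%N.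
  apply: (hN (fun i => lspan (c i))) => i; first exact: lspan_submod.
  by move=> x hx; exists 0, x; rewrite scale0r add0r.
rewrite (eq_bigr (fun=> 1%N)); first by rewrite sum1_card card_ord ltnn.
move=> i _; rewrite asboolT // => e; apply: (fP (c i)); rewrite e /=.
have [s0 _ _] := lspan_submod (c i).
by exists 1, 0; rewrite scale1r addr0.
Qed.

Lemma fin_gen_quot (M N : lmodType L^c) (p : {linear M -> N}) :
  (forall y, exists x, p x = y) -> fin_gen M -> fin_gen N.
Proof.
move=> surj [n [g gP]]; exists n, (p \o g) => y.
have [x <-] := surj y; have [a ->] := gP x; exists a.
by rewrite linear_sum; apply: eq_bigr => i _; rewrite linearZ.
Qed.

(** The image of a chain in N is a chain in M with the same strict steps. This gives the category of
    finitely generated modules its kernels. *)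
Lemma fin_gen_sub (M N : lmodType L^c) (i : {linear N -> M}) :
  injective i -> fin_gen M -> fin_gen N.
Proof.
move=> inj /HL[b hb]; apply: bounded_fin_gen; exists b => c cs cS n.
pose d k := [set i x | x in c k].
have ds k : submod (d k).
  have [c0 cD cZ] := cs k; split; first by exists 0; rewrite ?linear0.
    by move=> _ _ [x cx <-] [y cy <-]; exists (x + y); [apply: cD|rewrite linearD].
  by move=> a _ [x cx <-]; exists (a *: x); [apply: cZ|rewrite linearZ].
apply: leq_trans (hb d ds _ n); last by move=> k _ [x cx <-]; exists x => //; apply: cS.
apply: leq_sum => k _; have [e|/asboolT -> ] := pselect (d k = d k.+1); last first.
  by rewrite leq_b1.
rewrite asboolF //; apply; apply/seteqP; split; first exact: cS.
move=> x cx; have : d k (i x) by rewrite e; exists x.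
by move=> [y cy /inj <-].
Qed.

Lemma fin_gen_rV n : fin_gen ('rV[L^c]_n : lmodType L^c).
Proof.
by exists n, (fun i => delta_mx 0 i) => x; exists (x 0); apply: row_sum_delta.
Qed.

Lemma fin_gen_prod (M N : lmodType L^c) : fin_gen M -> fin_gen N ->
  fin_gen (M * N)%type.
Proof.
move=> [m [g gP]] [n [h hP]].
exists (m + n)%N, (fun i => match split i with inl j => (g j, 0) | inr j => (0, h j) end).
move=> [x y]; have [a ->] := gP x; have [b ->] := hP y.
exists (fun i => match split i with inl j => a j | inr j => b j end).
rewrite big_split_ord /=.
have sl i : split (lshift n i) = inl i :> 'I_m + 'I_n by apply: (unsplitK (inl i)).
have sr i : split (rshift m i) = inr i :> 'I_m + 'I_n by apply: (unsplitK (inr i)).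
under [X in _ = X + _]eq_bigr do rewrite sl.
under [X in _ = _ + X]eq_bigr do rewrite sr.
rewrite -[LHS]/(\sum_i a i *: g i, \sum_i b i *: h i).
have pD (u u' : M) (v v' : N) : (u, v) + (u', v') = (u + u', v + v') :> M * N by [].
have pZ c (u : M) (v : N) : c *: ((u, v) : M * N) = (c *: u, c *: v) by [].
have -> u v : (u, v) = (u, 0) + (0, v) :> M * N by rewrite pD addr0 add0r.
congr (_ + _).
  rewrite (big_morph (fun x => (x, 0) : M * N) (id1 := 0) (op1 := +%R)) //.
    by apply: eq_bigr => i _; rewrite pZ scaler0.
  by move=> u v; rewrite pD addr0.
rewrite (big_morph (fun x => (0, x) : M * N) (id1 := 0) (op1 := +%R)) //.
  by apply: eq_bigr => i _; rewrite pZ scaler0.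
by move=> u v; rewrite pD addr0.
Qed.

End FinGen.

Section Constructions.
Variable S : pzRingType.

Lemma submod_ker (M N : lmodType S) (p : {linear M -> N}) :
  submod [set x | p x = 0].
Proof.
split=> /=; first exact: linear0.
  by move=> x y; rewrite linearD => -> ->; rewrite addr0.
by move=> a x; rewrite linearZ /= => ->; rewrite scaler0.
Qed.

Lemma submod_im (M N : lmodType S) (p : {linear M -> N}) (A : set M) :
  submod A -> submod [set p x | x in A].
Proof.
move=> [A0 AD AZ]; split; first by exists 0; rewrite ?linear0.
  by move=> _ _ [x Ax <-] [y Ay <-]; exists (x + y); [apply: AD|rewrite linearD].
by move=> a _ [x Ax <-]; exists (a *: x); [apply: AZ|rewrite linearZ].
Qed.

Lemma submod_preim (M N : lmodType S) (p : {linear M -> N}) (A : set N) :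
  submod A -> submod [set x | A (p x)].
Proof.
move=> [A0 AD AZ]; split=> /=; first by rewrite linear0.
  by move=> x y; rewrite linearD; apply: AD.
by move=> a x; rewrite linearZ; apply: AZ.
Qed.

Lemma submodT (M : lmodType S) : submod [set: M].
Proof. by []. Qed.

Lemma submod0 (M : lmodType S) : submod [set (0 : M)].
Proof.
split=> [//|_ _ -> ->|a _ ->]; first by rewrite /= addr0.
by rewrite /= scaler0.
Qed.

Lemma kerP (M N : lmodType S) (p : {linear M -> N}) x y :
  p x = p y <-> p (x - y) = 0.
Proof.
rewrite linearB; split=> [->|/eqP]; first by rewrite subrr.
by rewrite subr_eq0 => /eqP.
Qed.

Lemma injP (M N : lmodType S) (p : {linear M -> N}) :
  (forall x, p x = 0 -> x = 0) -> injective p.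
Proof.
by move=> h x y /kerP/h/eqP; rewrite subr_eq0 => /eqP.
Qed.

End Constructions.

(** * Kernels, images, projectives and free modules *)

Section FgModules.
Variable L : pzRingType.
Hypothesis HL : forall M : lmodType L^c, fin_gen M -> bounded_chains (@submod _ M).
Implicit Types M N P K D Q : fgmod L.

Lemma fg_sub M (A : set M) : submod A ->
  exists N (i : {linear N -> M}), injective i /\ forall x, A x <-> exists y, i y = x.
Proof.
move=> /sub_exists[N [i [inj im]]].
by exists (FGMod (fin_gen_sub HL inj (fgmodP M))), i.
Qed.

Lemma fg_quot M (A : set M) : submod A ->
  exists N (p : {linear M -> N}),
    (forall y, exists x, p x = y) /\ forall x, p x = 0 <-> A x.
Proof.
move=> /quot_exists[N [p [surj ker]]].
by exists (FGMod (fin_gen_quot surj (fgmodP M))), p.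
Qed.

Lemma fg_ker M N (p : {linear M -> N}) : exists K (i : {linear K -> M}),
  injective i /\ forall x, p x = 0 <-> exists y, i y = x.
Proof. by have [K [i h]] := fg_sub (submod_ker p); exists K, i. Qed.

Lemma fg_im M N (f : {linear M -> N}) : exists D (i : {linear D -> N})
  (p : {linear M -> D}),
  [/\ injective i, forall y, exists x, p x = y & forall x, i (p x) = f x].
Proof.
have [D [i [inj im]]] := fg_sub (submod_im f (@submodT _ M)).
have [x|p pE] := @factor_inj _ _ _ _ i f inj.
  by apply/im; exists x.
exists D, i, p; split=> // y.
have /im[x _ e] : exists y', i y' = i y by exists y.
by exists x; apply: inj; rewrite pE.
Qed.

Definition fg_prod M N : fgmod L := FGMod (fin_gen_prod (fgmodP M) (fgmodP N)).
Definition fg_free n : fgmod L := FGMod (fin_gen_rV L n).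

Lemma inflation_modc (M N : modc L) (f : hom M N) : inflation f <-> inj_map f.
Proof.
split=> [[Z [g [injf _ _]]]|inj]; first exact: injf.
have [Q [p [surj ker]]] := fg_quot (submod_im f (@submodT _ M)).
exists Q, p; split=> // y; split=> [/ker[x _ <-]|[x <-]]; first by exists x.
by apply/ker; exists x.
Qed.

Lemma deflation_modc (M N : modc L) (g : hom M N) : deflation g <-> surj_map g.
Proof.
split=> [[Z [f [_ _ surj]]]|surj]; first exact: surj.
by have [K [i [inj im]]] := fg_ker g; exists K, i; split.
Qed.

Definition projm P : Prop :=
  forall M N (g : {linear M -> N}) (f : {linear P -> N}),
    (forall y, exists x, g x = y) -> exists h : {linear P -> M}, forall x, g (h x) = f x.

Lemma projective_modc (P : modc L) : projective_obj P <-> projm P.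
Proof.
split=> [h M N g f surj|h M N g /deflation_modc surj f].
  have [|k e] := h M N g _ f; first exact/deflation_modc.
  by exists k => x; rewrite -e.
by have [k e] := h M N g f surj; exists k; apply: lhomP.
Qed.

Lemma injective_modc (I : modc L) : injective_obj I ->
  forall M N (i : {linear M -> N}) (f : {linear M -> I}), injective i ->
  exists g : {linear N -> I}, forall x, g (i x) = f x.
Proof.
move=> h M N i f inj.
have [|g e] := h M N i _ f; first exact/inflation_modc.
by exists g => x; rewrite -e.
Qed.

(** Only the image of [f] has to be covered by [A]: projectivity is applied to the map from [A] onto
    its image under [g], through which [f] factors. *)
Lemma proj_lift P : projm P ->
  forall M N (A : set M) (g : {linear M -> N}) (f : {linear P -> N}),
    submod A -> (forall x, exists2 y, A y & g y = f x) ->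
    exists2 h : {linear P -> M}, (forall x, A (h x)) & forall x, g (h x) = f x.
Proof.
move=> hP M N A g f sA gf.
have [A' [i [injA imA]]] := fg_sub sA.
have [D [j [p [injj surjp pE]]]] := fg_im (g \o i : {linear A' -> N}).
have [x|f' f'E] := @factor_inj _ _ _ _ j f injj.
  have [y /imA[y' <-] <-] := gf x; exists (p y'); exact: pE.
have [h hE] := hP A' D p f' surjp.
exists (i \o h : {linear P -> M}) => x /=; first by apply/imA; exists (h x).
by have /= <- := pE (h x); rewrite hE f'E.
Qed.

Lemma proj_retract P M (i : {linear P -> M}) (p : {linear M -> P}) :
  (forall x, p (i x) = x) -> projm M -> projm P.
Proof.
move=> pi hM A B g f surj.
have [h hE] := hM A B g (f \o p : {linear M -> B}) surj.
by exists (h \o i : {linear P -> A}) => x /=; rewrite hE /= pi.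
Qed.

Definition comb_map n M (a : 'I_n -> M) (v : 'rV[L^c]_n) : M := \sum_i v 0 i *: a i.

Fact comb_map_linear n M (a : 'I_n -> M) : linear (comb_map a).
Proof.
move=> c u v; rewrite /comb_map scaler_sumr -big_split; apply: eq_bigr => i _ /=.
by rewrite !mxE scalerDl scalerA.
Qed.

HB.instance Definition _ n M (a : 'I_n -> M) :=
  GRing.isLinear.Build L^c 'rV[L^c]_n M *:%R (comb_map a) (comb_map_linear a).

Lemma comb_map_delta n M (a : 'I_n -> M) i : comb_map a (delta_mx 0 i) = a i.
Proof.
rewrite /comb_map (bigD1 i) //= big1 ?addr0 => [|j ji].
  by rewrite mxE !eqxx scale1r.
by rewrite mxE (negPf ji) andbF scale0r.
Qed.

Lemma free_ext n M (f g : {linear fg_free n -> M}) :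
  (forall i, f (delta_mx 0 i) = g (delta_mx 0 i)) -> forall x, f x = g x.
Proof.
move=> h x; rewrite [x : 'rV_n]row_sum_delta !linear_sum.
by apply: eq_bigr => i _; rewrite !linearZ /= h.
Qed.

Lemma free_proj n : projm (fg_free n).
Proof.
move=> M N g f surj.
have [a aE] := choice (fun i : 'I_n => surj (f (delta_mx 0 i))).
exists (comb_map a : {linear fg_free n -> M}) => x.
apply: (@free_ext n N (g \o comb_map a : {linear fg_free n -> N}) f) => i /=.
by rewrite comb_map_delta aE.
Qed.

Lemma free_cover M : exists n (p : {linear fg_free n -> M}),
  forall y, exists x, p x = y.
Proof.
have [n [g gP]] := fgmodP M; exists n, (comb_map g : {linear fg_free n -> M}) => y.
have [a ->] := gP y; exists (\row_i a i); apply: eq_bigr => i _.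
by rewrite mxE.
Qed.

End FgModules.

(** * Multiplicities and indecomposable projectives *)

Section Multiplicity.
Variable L : pzRingType.
Hypothesis HL : forall M : lmodType L^c, fin_gen M -> bounded_chains (@submod _ M).
Implicit Types M N P K D Q A B C : fgmod L.

Definition mchain M (c : nat -> set M) : Prop :=
  (forall i, submod (c i)) /\ forall i, c i `<=` c i.+1.

(** For projective [P] and submodules X inside Y this says that Hom(P, Y/X) is nonzero, without
    forming the quotient. *)
Definition hit P M (X Y : set M) : Prop :=
  exists2 f : {linear P -> M}, (forall x, Y (f x)) & ~ (forall x, X (f x)).

Definition hits P M (c : nat -> set M) n : nat :=
  (\sum_(i < n) `[< hit P (c i) (c i.+1) >])%N.

(* For projective P, this is the length of Hom(P, M) over End(P). *)
Definition mult P M : nat :=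
  xget 0%N (fun k => (exists2 c, mchain c & exists n, hits P (c : nat -> set M) n = k) /\
    forall c n, mchain c -> (hits P (c : nat -> set M) n <= k)%N).

(** A hit along a chain needs a strict step, so the chain bound makes the maximum exist and the
    default of [xget] never intervenes. *)
Lemma mult_spec P M :
  (exists2 c, mchain c & exists n, hits P (c : nat -> set M) n = mult P M) /\
  forall c n, mchain c -> (hits P (c : nat -> set M) n <= mult P M)%N.
Proof.
pose V k := exists2 c, mchain c & exists n, hits P (c : nat -> set M) n = k.
apply: (@xgetPex _ 0%N (fun k => V k /\ forall c n, mchain c -> (hits P c n <= k)%N)).
have [N hN] := HL (fgmodP M).
have bound c n : mchain c -> (hits P (c : nat -> set M) n <= N)%N.
  move=> [cs cS]; apply: leq_trans (hN c cs cS n); apply: leq_sum => i _.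
  have [h|nh] := pselect (hit P (c i) (c i.+1)); last by rewrite asboolF.
  rewrite (asboolT h) asboolT // => e; case: h => f.
  by rewrite -e.
have V0 : exists k, `[< V k >].
  exists 0%N; apply/asboolP; exists (fun=> setT); first by split.
  by exists 0%N; rewrite /hits big_ord0.
have VN k : `[< V k >] -> (k <= N)%N by move=> /asboolP[c mc [n <-]]; apply: bound.
case: (ex_maxnP V0 VN) => k /asboolP Vk kmax; exists k; split=> // c n mc.
by apply/kmax/asboolP; exists c => //; exists n.
Qed.

Lemma mult_gt0 P M : (0 < mult P M)%N <-> exists (f : {linear P -> M}) x, f x <> 0.
Proof.
have [[c [cs cS] [n hn]] hmax] := mult_spec P M.
split=> [|[f [x fx]]].
  rewrite -hn lt0n => /eqP h0; apply: contrapT => nof; apply: h0.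
  rewrite /hits big1 // => i _; rewrite asboolF // => -[f _]; apply=> x.
  have [c0 _ _] := cs i.
  have [-> //|fx] := pselect (f x = 0).
  by exfalso; apply: nof; exists f, x.
pose d i : set M := if i is 0%N then [set 0] else setT.
have := hmax d 1%N; rewrite /hits big_ord1 asboolT; first apply.
  split=> [[|i]|[|i]] //; exact: submod0.
by exists f => // /(_ x).
Qed.

Section Additivity.
Variables (P A B C : fgmod L) (i : {linear A -> B}) (p : {linear B -> C}).
Hypotheses (projP : projm P) (ses : short_exact i p).

(** A chain of B is cut into its preimage in A and its image in C. If a map f hits a step of B but
    the image step is not hit, p f lifts to a map g into the smaller submodule; then f - g factors
    through A and hits the preimage step. *)
Lemma mult_subadd : (mult P B <= mult P A + mult P C)%N.
Proof.
have [inj ex surj] := ses.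
have [[c [cs cS] [n <-]] _] := mult_spec P B.
pose a k := [set x | c k (i x)].
pose b k := [set p x | x in c k].
apply: (@leq_trans (hits P a n + hits P b n)).
  rewrite /hits -big_split; apply: leq_sum => k _ /=.
  have [[f fc nfc]|nh] := pselect (hit P (c k) (c k.+1));
    last by rewrite [X in (nat_of_bool X <= _)%N]asboolF.
  have [|nb] := pselect (hit P (b k) (b k.+1)).
    by move/asboolT => ->; rewrite (leq_trans (leq_b1 _)) // leq_addl.
  have fb x : b k (p (f x)).
    move: x; apply: contrapT => nf; apply: nb.
    by exists (p \o f : {linear P -> C}) => // x; exists (f x).
  have [g gc gE] := proj_lift HL projP (f := p \o f : {linear P -> C}) (cs k) fb.
  have [x|h hE] := @factor_inj _ _ _ _ i (f \- g : {linear P -> B}) inj.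
    by apply/ex; rewrite /= linearB gE subrr.
  rewrite [X in (_ <= nat_of_bool X + _)%N]asboolT ?(leq_trans (leq_b1 _)) ?leq_addr //.
  exists h => [x|h'].
    by rewrite /a /= hE; apply: submodB => //; apply: cS.
  apply: nfc => x; rewrite -[f x](subrK (g x)).
  by have [_ cD _] := cs k; apply: cD => //; rewrite -[f x - g x]hE; apply: h'.
apply: leq_add; [apply: (proj2 (mult_spec P A))|apply: (proj2 (mult_spec P C))];
  split=> k.
- exact: submod_preim.
- by move=> x; apply: cS.
- exact: submod_im.
- by move=> _ [x cx <-]; exists x => //; apply: cS.
Qed.

(** An optimal chain of A is followed by the preimage of one of C; projectivity lifts the maps
    hitting the latter. *)
Lemma mult_superadd : (mult P A + mult P C <= mult P B)%N.
Proof.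
have [inj ex surj] := ses.
have [[a [sa aS] [m <-]] _] := mult_spec P A.
have [[c [cs cS] [n <-]] _] := mult_spec P C.
(* The step from m to m+1 joins the two chains, hence the m+1+n steps; a hit there is simply not
   counted. *)
pose d k := if (k <= m)%N then [set i x | x in a k] else [set x | c (k - m.+1)%N (p x)].
have pi x : p (i x) = 0 by apply/ex; exists x.
have md : mchain d.
  split=> k; rewrite /d.
    by case: ifP => _; [apply: submod_im|apply: submod_preim].
  have [km|km|->] := ltngtP k m.
  - by move=> _ [x ax <-]; exists x => //; apply: aS.
  - by rewrite subSn // => x; apply: cS.
  - move=> _ [x _ <-] /=; rewrite pi; by case: (cs (m.+1 - m.+1)%N).
have [_ dmax] := mult_spec P B; apply: leq_trans (dmax d (m.+1 + n)%N md).
rewrite /hits big_split_ord big_ord_recr /=.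
apply: leq_add.
  apply: leq_trans (leq_addr _ _); apply: leq_sum => k _ /=.
  have [[f fa nfa]|nh] := pselect (hit P (a k) (a k.+1));
    last by rewrite [X in (nat_of_bool X <= _)%N]asboolF.
  rewrite [X in (_ <= nat_of_bool X)%N]asboolT ?leq_b1 //.
  rewrite /d ltn_ord (ltnW (ltn_ord k)).
  exists (i \o f : {linear P -> B}) => [x|h]; first by exists (f x).
  by apply: nfa => x; have [y ay /inj <-] := h x.
apply: leq_sum => k _ /=.
have [[f fc nfc]|nh] := pselect (hit P (c k) (c k.+1));
    last by rewrite [X in (nat_of_bool X <= _)%N]asboolF.
rewrite [X in (_ <= nat_of_bool X)%N]asboolT ?leq_b1 //.
have km : (m < m.+1 + k)%N by apply: leq_addr.
rewrite /d leqNgt km /= ltnNge (ltnW km) /=.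
rewrite subSn ?leq_addr // addKn.
have [g gE] := projP f surj.
exists g => [x|h] /=; first by rewrite gE; apply: fc.
by apply: nfc => x; rewrite -gE; apply: h.
Qed.

Lemma mult_add : mult P B = (mult P A + mult P C)%N.
Proof. by apply/eqP; rewrite eqn_leq mult_subadd mult_superadd. Qed.

End Additivity.
End Multiplicity.

(** * Length, simple modules and Fitting's lemma *)

Section Lengths.
Variable L : pzRingType.
Hypothesis HL : forall M : lmodType L^c, fin_gen M -> bounded_chains (@submod _ M).
Implicit Types M N P K D Q A B C T : fgmod L.

(** Since Hom(L, M) = M, every strict inclusion of submodules is hit by the free module of rank 1,
    so this is the usual length and its additivity is a case of [mult_add]. *)
Definition len M : nat := mult (fg_free L 1) M.

Lemma free_hom n M (x : M) : exists f : {linear fg_free L n.+1 -> M},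
  f (delta_mx 0 0) = x.
Proof.
exists (comb_map (fun=> x) : {linear fg_free L n.+1 -> M}).
exact: comb_map_delta.
Qed.

Lemma len_gt0 M : (0 < len M)%N <-> exists x : M, x <> 0.
Proof.
split=> [/(mult_gt0 HL)[f [x fx]]|[x xn0]]; first by exists (f x).
apply/(mult_gt0 HL); have [f fE] := @free_hom 0 M x.
by exists f, (delta_mx 0 0); rewrite fE.
Qed.

Lemma len_eq0 M : len M = 0%N <-> forall x : M, x = 0.
Proof.
split=> [e x|h].
  apply: contrapT => xn0; have : (0 < len M)%N by apply/len_gt0; exists x.
  by rewrite e.
by apply/eqP; rewrite -leqn0 leqNgt; apply/negP => /len_gt0[x]; apply.
Qed.

Lemma zero_modc (M : modc L) : zero_obj M <-> forall x : M, x = 0.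
Proof.
split=> [[h _] x|h].
  have e : idm M = 0 by apply: h.
  by rewrite -[x]/((idm M : {linear M -> M}) x) e.
split=> N f; apply: lhomP => x /=; first by rewrite (h x) linear0.
exact: h.
Qed.

Lemma ses_ker M N (p : {linear M -> N}) : surj_map p ->
  exists K (i : {linear K -> M}), short_exact i p.
Proof. by move=> surj; have [K [i [inj ex]]] := fg_ker HL p; exists K, i; split. Qed.

Lemma ses_coker M N (i : {linear M -> N}) : injective i ->
  exists Q (p : {linear N -> Q}), short_exact i p.
Proof.
move=> inj; have [Q [p [surj ker]]] := fg_quot (submod_im i (@submodT _ M)).
exists Q, p; split=> // y; split=> [/ker[x _ <-]|[x <-]]; first by exists x.
by apply/ker; exists x.
Qed.

Lemma len_add A B C (i : {linear A -> B}) (p : {linear B -> C}) :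
  short_exact i p -> len B = (len A + len C)%N.
Proof. by apply: mult_add => //; apply: free_proj. Qed.

Lemma len_inj M N (i : {linear M -> N}) : injective i -> (len M <= len N)%N.
Proof.
by move=> /ses_coker[Q [p /len_add ->]]; apply: leq_addr.
Qed.

Lemma len_inj_surj M N (i : {linear M -> N}) : injective i ->
  (len N <= len M)%N -> surj_map i.
Proof.
move=> /ses_coker[Q [p ses]]; rewrite (len_add ses) -{2}(addn0 (len M)) leq_add2l.
by rewrite leqn0 => /eqP/len_eq0 Q0 y; case: ses => _ ex _; apply/ex; apply: Q0.
Qed.

Lemma len_surj M N (p : {linear M -> N}) : surj_map p -> (len N <= len M)%N.
Proof. by move=> /ses_ker[K [i /len_add ->]]; apply: leq_addl. Qed.

Lemma len_surj_inj M N (p : {linear M -> N}) : surj_map p ->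
  (len M <= len N)%N -> injective p.
Proof.
move=> /ses_ker[K [i ses]]; rewrite (len_add ses) -{2}(add0n (len N)) leq_add2r.
rewrite leqn0 => /eqP/len_eq0 K0; case: ses => _ ex _.
by apply: injP => x /ex[y <-]; rewrite (K0 y) linear0.
Qed.

(** Presents an isomorphism as a short exact sequence with zero third term, so that additivity alone
    yields invariance under isomorphism. *)
Lemma ses_iso M N (f : {linear M -> N}) : injective f -> surj_map f ->
  exists (Z : fgmod L) (p : {linear N -> Z}), short_exact f p /\ forall x : Z, x = 0.
Proof.
move=> inj surj; have [Z [p ses]] := ses_coker inj; exists Z, p; split=> // z.
case: ses => _ ex sp; have [y <-] := sp z; apply/ex; exact: surj.
Qed.

Lemma mult0 P M : (forall x : M, x = 0) -> mult P M = 0%N.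
Proof.
move=> M0; apply/eqP; rewrite -leqn0 leqNgt; apply/negP => /(mult_gt0 HL)[f [x]].
by rewrite (M0 (f x)).
Qed.

Lemma mult_iso P M N (f : {linear M -> N}) : projm P ->
  injective f -> surj_map f -> mult P M = mult P N.
Proof.
move=> hP inj surj; have [Z [p [ses Z0]]] := ses_iso inj surj.
by rewrite (mult_add HL hP ses) (mult0 P Z0) addn0.
Qed.

Definition smod T : Prop := (exists x : T, x <> 0) /\
  forall A : set T, submod A -> (forall x, A x -> x = 0) \/ (forall x, A x).

(** Induction on length: a module that is not simple has a nonzero proper submodule, and the
    quotient by it is nonzero and shorter. *)
Lemma simple_quot M : (exists x : M, x <> 0) ->
  exists T (p : {linear M -> T}), surj_map p /\ smod T.
Proof.
have [n] := ubnP (len M); elim: n M => // n IH M lM Mn0.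
have [sM|nsM] := pselect (smod M).
  by exists M, (idfun : {linear M -> M}); split=> // y; exists y.
have [A [sA nA0 nAT]] : exists A : set M,
    [/\ submod A, exists2 x, A x & x <> 0 & ~ forall x, A x].
  apply: contrapT => nex; apply: nsM; split=> // A sA.
  have [h|h] := pselect (forall x, A x); first by right.
  left=> x Ax; apply: contrapT => xn0; apply: nex; exists A; split=> //; by exists x.
have [Q [p [surj ker]]] := fg_quot sA.
have [K [i ses]] := ses_ker surj.
have lQ : (len Q < n)%N.
  rewrite ltnS (len_add ses) in lM; apply: leq_trans lM.
  rewrite -[X in (X < _)%N]add0n ltn_add2r; apply/len_gt0.
  have [x Ax xn0] := nA0; case: ses => _ ex _.
  have /ex[y yx] : p x = 0 by apply/ker.
  by exists y => y0; apply: xn0; rewrite -yx y0 linear0.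
have [|T [q [sq sT]]] := IH Q lQ.
  apply: contrapT => nQ; apply: nAT => x; apply/ker; apply: contrapT => px.
  by apply: nQ; exists (p x).
exists T, (q \o p : {linear M -> T}); split=> // y.
by have [z <-] := sq y; have [x <-] := surj z; exists x.
Qed.

Lemma smod_onto M T (f : {linear M -> T}) x : smod T -> f x <> 0 -> surj_map f.
Proof.
move=> [_ sT] fx; have [h|h] := sT _ (submod_im f (@submodT _ M)).
  by case: fx; apply: h; exists x.
by move=> y; have [z _ <-] := h y; exists z.
Qed.

Lemma smod_inj M T (f : {linear T -> M}) x : smod T -> f x <> 0 -> injective f.
Proof.
move=> [_ sT] fx; have [h|h] := sT _ (submod_ker f); first exact: injP.
by case: fx; apply: h.
Qed.

Lemma biproduct_ses (A B S : modc L) : biproduct A B S ->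
  exists (i : {linear A -> S}) (j : {linear B -> S}) (p : {linear S -> A})
    (q : {linear S -> B}),
   [/\ forall x, p (i x) = x, forall x, q (j x) = x, forall x, p (j x) = 0,
       forall x, q (i x) = 0 & forall x, i (p x) + j (q x) = x].
Proof.
move=> [i [j [p [q [e1 e2 e3 e4 e5]]]]]; exists i, j, p, q; split=> x.
- by rewrite -[RHS]/((idm A : {linear A -> A}) x) -e1.
- by rewrite -[RHS]/((idm B : {linear B -> B}) x) -e2.
- by rewrite -[LHS]/((p ∘ j : {linear B -> A}) x) e3.
- by rewrite -[LHS]/((q ∘ i : {linear A -> B}) x) e4.
- by rewrite -[RHS]/((idm S : {linear S -> S}) x) -e5.
Qed.

Lemma retract_biproduct K P (i : {linear K -> P}) (p : {linear P -> K}) :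
  (forall x, p (i x) = x) -> exists K', @biproduct (modc L) K K' P.
Proof.
move=> pi; have [K' [j [injj ker]]] := fg_ker HL p.
have [x|q qE] := @factor_inj _ _ _ _ j (idfun \- (i \o p) : {linear P -> P}) injj.
  by apply/ker => /=; rewrite linearB pi subrr.
have pj x : p (j x) = 0 by apply/ker; exists x.
exists K', i, j, p, q; split; apply: lhomP => x //=.
- by apply: injj; rewrite qE /= pj linear0 subr0.
- by apply: injj; rewrite qE /= pi subrr linear0.
- by rewrite qE /= addrC subrK.
Qed.

Lemma iter_linear P (e : {linear P -> P}) n :
  exists g : {linear P -> P}, forall x, g x = iter n e x.
Proof.
elim: n => [|n [g gE]]; first by exists idfun.
by exists (e \o g : {linear P -> P}) => x /=; rewrite gE.
Qed.

(** Take D of minimal length among the images of the powers of [e]. The corresponding power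
    restricts to an automorphism of D, so D is a direct summand of P. It is not zero, as [e] is not
    nilpotent; hence it is P. *)
Lemma fitting (P : modc L) (e : {linear P -> P}) : indecomposable P ->
  (forall n, exists x, iter n e x <> 0) -> injective e /\ surj_map e.
Proof.
move=> [_ indP] nilp.
suff se : surj_map e by split=> //; apply: len_surj_inj.
(* The exponent n.+1 is positive so that D lies in the image of [e]: once D is all of P, [e] is
   onto. *)
pose V k := exists n D (i : {linear D -> P}),
  [/\ injective i, forall x, (exists y, i y = x) <-> (exists y, iter n.+1 e y = x)
    & len D = k].
have Vim n : exists D (i : {linear D -> P}), injective i /\
    forall x, (exists y, i y = x) <-> (exists y, iter n.+1 e y = x).
  have [g gE] := iter_linear e n.+1.
  have [D [i [p [inj surj pE]]]] := fg_im HL g; exists D, i; split=> // x.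
  split=> [[y <-]|[y <-]]; first by have [z <-] := surj y; exists z; rewrite pE gE.
  by exists (p y); rewrite pE gE.
have Vex : exists k, `[< V k >].
  have [D [i [inj im]]] := Vim 0%N; exists (len D); apply/asboolP.
  by exists 0%N, D, i.
case: (ex_minnP Vex) => k /asboolP[n [D [i [inj im lD]]]] kmin.
have [g gE] := iter_linear e n.+1.
have [x|pi piE] := @factor_inj _ _ _ _ i g inj; first by apply/im; exists x; rewrite gE.
have spii : surj_map (pi \o i : {linear D -> D}).
  move=> y.
  (* The image of the power with exponent 2(n+1): it lies in D and by minimality is not shorter, so
     it fills D. *)
  have [D' [i' [inj' im']]] := Vim (n + n.+1)%N.
  have [x|j jE] := @factor_inj _ _ _ _ i i' inj.
    have /im'[z <-] : exists y, i' y = i' x by exists x.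
    by apply/im; exists (iter n.+1 e z); rewrite -iterD addSn.
  have sj : surj_map j.
    apply: len_inj_surj => [a b|].
      by move/(congr1 i); rewrite !jE => /inj'.
    rewrite lD; apply: kmin; apply/asboolP; by exists (n + n.+1)%N, D', i'.
  have [z zy] := sj y.
  have /im'[w ew] : exists y', i' y' = i y by exists z; rewrite -jE zy.
  exists (pi w); apply: inj => /=; rewrite !piE !gE -iterD addSn.
  exact: ew.
have ipii : injective (pi \o i : {linear D -> D}) by apply: len_surj_inj.
have [x|u uE] := @factor_inj _ _ _ _ (pi \o i : {linear D -> D}) idfun ipii.
  by have [y <-] := spii x; exists y.
have [|K' bip] := @retract_biproduct D P i (u \o pi : {linear P -> D}).
  by move=> x; apply: ipii; apply: uE.
have [D0|K'0] := indP _ _ bip.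
  have [x] := nilp n.+1; rewrite -gE -piE.
  by move/zero_modc: D0 => /(_ (pi x)) ->; rewrite linear0.
have [i1 [j1 [p1 [q1 [_ _ _ _ s1]]]]] := biproduct_ses bip.
have lP : (len P <= len D)%N.
  have inj1 : injective p1.
    apply: injP => x p1x; rewrite -(s1 x) p1x.
    by move/zero_modc: K'0 => /(_ (q1 x)) ->; rewrite !linear0 addr0.
  exact: len_inj inj1.
move=> y; have /im[z <-] := len_inj_surj inj lP y.
by exists (iter n e z).
Qed.

End Lengths.

(** The index that [pick] finds in the class of [i] depends only on the class and serves as its
    normal form. *)
Lemma distinct_representatives (X : Type) (r : X -> X -> Prop) n (Q : 'I_n -> X) :
  (forall x, r x x) -> (forall x y, r x y -> r y x) ->
  (forall x y z, r x y -> r y z -> r x z) ->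
  exists d (P : 'I_d -> X), [/\ forall k, exists i, P k = Q i,
    forall i, exists k, r (Q i) (P k) & forall k l, r (P k) (P l) -> k = l].
Proof.
move=> rr rs rt.
pose can i := odflt i [pick j | `[< r (Q i) (Q j) >]].
have canP i : r (Q i) (Q (can i)).
  by rewrite /can; case: pickP => [j /asboolP //|_] /=.
have can_eq i j : r (Q i) (Q j) -> can i = can j.
  move=> rij; rewrite /can.
  have -> : [pick l | `[< r (Q i) (Q l) >]] = [pick l | `[< r (Q j) (Q l) >]].
    by apply: eq_pick => l; apply: asbool_equiv_eq; split; apply: rt => //; apply: rs.
  by case: pickP => // /(_ j) /asboolP; case; apply: rr.
pose I := [set can i | i : 'I_n]%SET.
exists #|I|, (fun k => Q (enum_val k)); split=> [k|i|k l].
- by exists (enum_val k).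
- have Ii : can i \in I by apply: imset_f.
  by exists (enum_rank_in Ii (can i)); rewrite enum_rankK_in.
- move=> /can_eq e; apply: enum_val_inj.
  have cc i : i \in I -> can i = i.
    by move=> /imsetP[j _ ->]; apply: can_eq; apply: rs.
  by rewrite -(cc _ (enum_valP k)) -(cc _ (enum_valP l)).
Qed.

Lemma isomorphic_refl (C : preexact) (X : C) : isomorphic X X.
Proof. by exists (idm X), (idm X); rewrite comp1m. Qed.

Lemma isomorphic_sym (C : preexact) (X Y : C) : isomorphic X Y -> isomorphic Y X.
Proof. by move=> [f [g gf fg]]; exists g, f. Qed.

Lemma isomorphic_trans (C : preexact) (X Y Z : C) :
  isomorphic X Y -> isomorphic Y Z -> isomorphic X Z.
Proof.
move=> [f [f' f'f ff']] [g [g' g'g gg']]; exists (g ∘ f), (f' ∘ g').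
  by rewrite compA -(compA f') g'g compm1.
by rewrite compA -(compA g) ff' compm1.
Qed.

(** * Indecomposable projectives and their simple quotients *)

Section Projectives.
Variable L : pzRingType.
Hypothesis HL : forall M : lmodType L^c, fin_gen M -> bounded_chains (@submod _ M).
Implicit Types M N P K D Q A B C T : fgmod L.

Lemma iso_mor_modc (M N : modc L) (f : hom M N) :
  iso_mor f <-> inj_map f /\ surj_map f.
Proof.
split=> [[g gf fg]|[inj surj]].
  split=> [x y e|y].
    rewrite -[x]/((idm M : {linear M -> M}) x) -[y]/((idm M : {linear M -> M}) y).
    by rewrite -gf /= e.
  by exists ((g : {linear N -> M}) y); rewrite -[RHS]/((idm N : {linear N -> N}) y) -fg.
have [y|g gE] := @factor_inj _ _ _ _ f idfun inj; first exact: surj.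
by exists g; apply: lhomP => x //=; apply: inj; apply: gE.
Qed.

Lemma isomorphic_modc (M N : modc L) :
  isomorphic M N <-> exists f : {linear M -> N}, injective f /\ surj_map f.
Proof. by split=> -[f /iso_mor_modc h]; exists f. Qed.

Definition indproj (P : modc L) : Prop := indecomposable P /\ projm P.

Lemma indproj_iso (P P' : modc L) : isomorphic P P' -> indproj P -> indproj P'.
Proof.
move=> [a [b ba ab]] [[nz ind] pP].
have baE x : (b : {linear P' -> P}) ((a : {linear P -> P'}) x) = x.
  by rewrite -[RHS]/((idm P : {linear P -> P}) x) -ba.
have abE x : (a : {linear P -> P'}) ((b : {linear P' -> P}) x) = x.
  by rewrite -[RHS]/((idm P' : {linear P' -> P'}) x) -ab.
split; last exact: proj_retract abE pP.
split=> [/zero_modc z|A B [i [j [p [q [e1 e2 e3 e4 e5]]]]]].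
  by apply: nz; apply/zero_modc => x; rewrite -(baE x) (z ((a : {linear P -> P'}) x)) linear0.
apply: ind; exists (b ∘ i), (b ∘ j), (p ∘ a), (q ∘ a).
have e (X Y : modc L) (f : hom X P') (g : hom P' Y) : (g ∘ a) ∘ (b ∘ f) = g ∘ f.
  by rewrite -compA (compA a) ab comp1m.
split; rewrite ?e //.
by rewrite -!compA (compA i) (compA j) -compDr -compDl e5 comp1m.
Qed.

(** Since q e^n = q is nonzero for all n, [e] is not nilpotent and Fitting's lemma applies. *)
Lemma indproj_endo (P : modc L) T (q : {linear P -> T}) (e : {linear P -> P}) :
  indproj P -> (exists x, q x <> 0) -> (forall x, q (e x) = q x) ->
  injective e /\ surj_map e.
Proof.
move=> [indP _] [x qx] qe; apply: fitting => // n; exists x => ex0.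
apply: qx; suff <- : q (iter n e x) = q x by rewrite ex0 linear0.
by elim: n {ex0} => //= n <-.
Qed.

(** Lift [q] and [q'] through each other; both composites of the lifts are compatible with the maps
    to T, hence bijective by [indproj_endo]. *)
Lemma indproj_cover_unique (P P' : modc L) T (q : {linear P -> T})
    (q' : {linear P' -> T}) :
  indproj P -> indproj P' -> (exists x : T, x <> 0) ->
  surj_map q -> surj_map q' -> isomorphic P P'.
Proof.
move=> hP hP' [t tn0] sq sq'.
have [a aE] := (proj2 hP) _ _ q' q sq'.
have [b bE] := (proj2 hP') _ _ q q' sq.
have [||iba _] := @indproj_endo P T q (b \o a : {linear P -> P}) hP.
- by have [x qx] := sq t; exists x; rewrite qx.
- by move=> x /=; rewrite bE aE.
have [||_ sab] := @indproj_endo P' T q' (a \o b : {linear P' -> P'}) hP'.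
- by have [x qx] := sq' t; exists x; rewrite qx.
- by move=> x /=; rewrite aE bE.
apply/isomorphic_modc; exists a; split=> [x y e|y].
  by apply: iba; rewrite /= e.
by have [x <-] := sab y; exists (b x).
Qed.

(** If ker q' lies in ker q, then T is a nonzero quotient of the simple module T'. Otherwise q maps
    ker q' onto T, which leads to an automorphism of P with image in the proper submodule ker q'. *)
Lemma indproj_top_unique (P : modc L) T T' (q : {linear P -> T})
    (q' : {linear P -> T'}) : indproj P -> smod T -> smod T' ->
  surj_map q -> surj_map q' -> exists f : {linear T' -> T}, injective f /\ surj_map f.
Proof.
move=> hP sT sT' sq sq'.
have [h|nh] := pselect (forall x, q' x = 0 -> q x = 0).
  have [f fE] := factor_surj sq' h.
  have sf : surj_map f by move=> y; have [x <-] := sq y; exists (q' x).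
  exists f; split=> //; have [[t tn0] _] := sT; have [t' ft'] := sf t.
  by apply: (smod_inj (x := t')) => //; rewrite ft'.
exfalso; have [x q'x qx] : exists2 x, q' x = 0 & q x <> 0.
  apply: contrapT => nx; apply: nh => x q'x; apply: contrapT => qx.
  by apply: nx; exists x.
have [_ sub] := sT.
have kq' := submod_ker q'.
have [h0|h1] := sub _ (submod_im q kq').
  by apply: qx; apply: h0; exists x.
(* a lift of q through ker q' is an automorphism of P with image in ker q' *)
have [|h hq' hq] := proj_lift HL (proj2 hP) (g := q) (f := q) kq'.
  by move=> y; have [z ? ?] := h1 (q y); exists z.
have [||_ sh] := @indproj_endo P T q h hP.
- by exists x.
- exact: hq.
have [[t' t'n0] _] := sT'; have [y q'y] := sq' t'.
by have [z zy] := sh y; apply: t'n0; rewrite -q'y -zy; apply: hq'.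
Qed.

(** The decomposition into indecomposables is recorded only through nonzero maps out of the
    summands, which is stable under splitting P in two and avoids n-fold direct sums. *)
Lemma proj_decomposition P : projm P -> exists n (Q : 'I_n -> modc L),
  (forall k, indproj (Q k)) /\
  forall M (f : {linear P -> M}) x, f x <> 0 ->
    exists k (g : {linear Q k -> M}) y, g y <> 0.
Proof.
have [m] := ubnP (len P); elim: m P => // m IH P lP hP.
have [P0|nP0] := pselect (forall x : P, x = 0).
  exists 0%N, (fun=> P : modc L); split=> [[]//|M f x].
  by rewrite (P0 x) linear0.
have [indP|nindP] := pselect (@indecomposable (modc L) P).
  exists 1%N, (fun=> P : modc L); split=> // M f x fx.
  by exists ord0, f, x.
have [A [B [bip nA nB]]] : exists A B : modc L,
    [/\ biproduct A B P, ~ zero_obj A & ~ zero_obj B].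
  apply: contrapT => nAB; apply: nindP; split; first by move/zero_modc.
  move=> A B bip; have [zA|nzA] := pselect (zero_obj A); first by left.
  by right; apply: contrapT => nzB; apply: nAB; exists A, B.
have [i [j [p [q [pi qj pj qi s]]]]] := biproduct_ses bip.
have lAB : len P = (len A + len B)%N.
  apply: (@len_add L HL A P B i q); split.
  - by move=> x y /(congr1 p); rewrite !pi.
  - move=> y; split=> [qy|[x <-]]; last exact: qi.
    by exists (p y); rewrite -[RHS]s qy linear0 addr0.
  - by move=> y; exists (j y).
have pos (D : modc L) : ~ zero_obj D -> (0 < len D)%N.
  move=> nD; rewrite lt0n; apply/eqP => /(len_eq0 HL) D0; apply: nD.
  exact/zero_modc.
have [||n1 [Q1 [h1 c1]]] := IH A.
- by rewrite -ltnS; apply: leq_trans lP; rewrite lAB ltnS -addn1 leq_add2l pos.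
- exact: proj_retract hP.
have [||n2 [Q2 [h2 c2]]] := IH B.
- by rewrite -ltnS; apply: leq_trans lP; rewrite lAB ltnS -add1n leq_add2r pos.
- exact: proj_retract hP.
exists (n1 + n2)%N, (fun k => match split k with inl a => Q1 a | inr b => Q2 b end).
split=> [k|M f x fx]; first by case: split.
have [fi|fi] := pselect (f (i (p x)) = 0).
  have fj : (f \o j : {linear B -> M}) (q x) <> 0.
    by move=> /= fj; apply: fx; rewrite -(s x) linearD fi fj addr0.
  have [k [g [y gy]]] := c2 _ _ _ fj.
  exists (rshift n1 k).
  by rewrite (unsplitK (inr k) : split (rshift n1 k) = _); exists g, y.
have [k [g [y gy]]] := c1 _ (f \o i : {linear A -> M}) _ fi.
exists (lshift n2 k).
by rewrite (unsplitK (inl k) : split (lshift n2 k) = _); exists g, y.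
Qed.

(** The [P k] are the indecomposable summands of L up to isomorphism. A simple module is a quotient
    of L, hence of some [P k]. A nonzero map from [P j] to the simple quotient [T k] of [P k] is
    onto, so covers being unique forces j = k: the matrix of multiplicities is diagonal with
    positive entries. *)
Lemma simple_projective_duality : exists d (P : 'I_d -> modc L) (T : 'I_d -> fgmod L),
  [/\ (forall k, indproj (P k)) /\ (forall k, smod (T k)),
      forall Q : modc L, indproj Q -> exists k, isomorphic Q (P k),
      forall k l, isomorphic (P k) (P l) -> k = l,
      forall T', smod T' ->
        exists k (f : {linear T' -> T k}), injective f /\ surj_map f &
      forall j k, (0 < mult (P j) (T k))%N = (j == k)].
Proof.
have [n [Q [hQ cQ]]] := proj_decomposition (@free_proj L 1).
have [d [P [PQ QP Pinj]]] := @distinct_representatives _ (@isomorphic (modc L)) n Q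
  (@isomorphic_refl _) (@isomorphic_sym _) (@isomorphic_trans _).
have hP k : indproj (P k) by have [i ->] := PQ k.
have cover T : smod T -> exists k (q : {linear P k -> T}), surj_map q.
  move=> sT; have [[t tn0] _] := sT.
  have [f fE] := @free_hom L 0 T t.
  have [|i [g [y gy]]] := cQ T f (delta_mx 0 0); first by rewrite fE.
  have sg := smod_onto sT gy.
  have [k /isomorphic_sym/isomorphic_modc[a [_ sa]]] := QP i.
  exists k, (g \o a : {linear P k -> T}) => z.
  by have [w <-] := sg z; have [v <-] := sa w; exists v.
have topk k : exists (T : fgmod L) (q : {linear P k -> T}), surj_map q /\ smod T.
  apply: simple_quot => //; apply: contrapT => nx.
  have [[nz _] _] := hP k; apply: nz; apply/zero_modc => x.
  by apply: contrapT => xn0; apply: nx; exists x.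
have [T TP] := choice topk.
have sT k : smod (T k) by have [q []] := TP k.
exists d, P, T; split=> //.
- move=> P' hP'.
  have [|T' [q' [sq' sT']]] := @simple_quot L HL P'.
    apply: contrapT => nx; have [[nz _] _] := hP'; apply: nz; apply/zero_modc => x.
    by apply: contrapT => xn0; apply: nx; exists x.
  have [k [q sq]] := cover T' sT'.
  by exists k; apply: (indproj_cover_unique hP' (hP k) _ sq' sq); case: sT'.
- move=> T' sT'; have [k [q sq]] := cover T' sT'; exists k.
  have [q0 [sq0 _]] := TP k.
  exact: (indproj_top_unique (hP k) (sT k) sT' sq0 sq).
move=> j k; have [q0 [sq0 _]] := TP k.
apply/idP/eqP => [/(mult_gt0 HL)[f [x fx]]|->].
  apply: Pinj; apply: (indproj_cover_unique (hP j) (hP k) _ (smod_onto (sT k) fx) sq0).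
  by case: (sT k).
apply/(mult_gt0 HL); have [[t tn0] _] := sT k; have [x qx] := sq0 t.
by exists q0, x; rewrite qx.
Qed.

End Projectives.

(** * Ext through an injective resolution *)

Section Lifting.
Variable L : pzRingType.
Hypothesis HL : forall M : lmodType L^c, fin_gen M -> bounded_chains (@submod _ M).
Implicit Types M N P K D Q A B C X Y : fgmod L.

(* An injective coresolution J 0 -> J 1 -> J 2 -> ... of J 0 = U. *)
Variables (J : nat -> fgmod L) (dJ : forall j, {linear J j -> J j.+1}).
Hypothesis J_exact : forall j y, dJ j.+1 y = 0 <-> exists x, dJ j x = y.
Hypothesis J_inj0 : injective (dJ 0).
Hypothesis J_ext : forall j M N (i : {linear M -> N}) (f : {linear M -> J j.+1}),
  injective i -> exists g : {linear N -> J j.+1}, forall x, g (i x) = f x.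

(* Hom(X, J) is exact at J j.+1, that is, Ext^j(X, U) = 0 when j > 0. *)
Definition lifts j X : Prop := forall f : {linear X -> J j.+1},
  (forall x, dJ j.+1 (f x) = 0) ->
  exists g : {linear X -> J j}, forall x, dJ j (g x) = f x.

Lemma dJ_dJ j x : dJ j.+1 (dJ j x) = 0.
Proof. by apply/J_exact; exists x. Qed.

Lemma lifts0 X : lifts 0 X.
Proof.
by move=> f df; apply: factor_inj => // x; apply/J_exact.
Qed.

Lemma lifts_proj j P : projm P -> lifts j P.
Proof.
move=> hP f df.
have [|h _ hE] := proj_lift HL hP (g := dJ j) (f := f) (@submodT _ _).
  by move=> x; have /J_exact[y <-] := df x; exists y.
by exists h.
Qed.

Section ShortExact.
Variables (A B C : fgmod L) (i : {linear A -> B}) (p : {linear B -> C}).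
Hypothesis ses : short_exact i p.

Let pi x : p (i x) = 0.
Proof. by case: ses => _ ex _; apply/ex; exists x. Qed.

Let factor_p (D : fgmod L) (f : {linear B -> D}) : (forall x, f (i x) = 0) ->
  exists g : {linear C -> D}, forall x, g (p x) = f x.
Proof.
case: ses => _ ex surj fi; apply: factor_surj => // x /ex[y <-]; exact: fi.
Qed.

Let surj_p y : exists x, p x = y.
Proof. by case: ses => _ _; apply. Qed.

Let inj_i : injective i. Proof. by case: ses. Qed.

(** A lift on A extends to B because [J j.+1] is injective, and the remaining defect factors through
    C. The index is j.+1 since [J 0], which is U, need not be injective. *)
Lemma lifts_ext j : lifts j.+1 A -> lifts j.+1 C -> lifts j.+1 B.
Proof.
move=> lA lC f df.
have [|g gE] := lA (f \o i : {linear A -> J j.+2}); first by move=> x; apply: df.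
have [g' g'E] := J_ext g inj_i.
have [x|h hE] := @factor_p _ (f \- (dJ j.+1 \o g') : {linear B -> J j.+2}).
  by rewrite /= g'E gE subrr.
have [|k kE] := lC h.
  by move=> y; have [x <-] := surj_p y; rewrite hE /= linearB df dJ_dJ subrr.
exists (g' \+ (k \o p) : {linear B -> J j.+1}) => x /=.
by rewrite linearD kE hE /= addrC subrK.
Qed.

(* The obstruction lies in Ext^1(C, ker (dJ j.+1)) = Ext^(j+1)(C, U). *)
Lemma lifts_corrected j (f : {linear A -> J j.+1}) : lifts j.+1 C ->
  (forall x, dJ j.+1 (f x) = 0) -> exists2 F : {linear B -> J j.+1},
    (forall x, dJ j.+1 (F x) = 0) & forall x, F (i x) = f x.
Proof.
move=> lC df; have [F FE] := J_ext f inj_i.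
have [x|h hE] := @factor_p _ (dJ j.+1 \o F : {linear B -> J j.+2}).
  by rewrite /= FE df.
have [|g gE] := lC h.
  by move=> y; have [x <-] := surj_p y; rewrite hE /= dJ_dJ.
exists (F \- (g \o p) : {linear B -> J j.+1}) => x /=.
  by rewrite linearB gE hE subrr.
by rewrite FE pi linear0 subr0.
Qed.

(** The part Ext^j(B, U) -> Ext^j(A, U) -> Ext^(j+1)(C, U) of the long exact sequence. *)
Lemma lifts_ker j : lifts j B -> lifts j.+1 C -> lifts j A.
Proof.
move=> lB lC f df; have [F dF FE] := lifts_corrected lC df.
have [G GE] := lB F dF; exists (G \o i : {linear A -> J j}) => x /=.
by rewrite GE FE.
Qed.

Lemma lifts1_extend (f : {linear A -> J 0}) : lifts 1 C ->
  exists g : {linear B -> J 0}, forall x, g (i x) = f x.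
Proof.
move=> lC; have [|F dF FE] := lifts_corrected (f := dJ 0 \o f : {linear A -> J 1}) lC.
  by move=> x; apply: dJ_dJ.
have [g gE] := lifts0 dF; exists g => x.
by apply: J_inj0; rewrite gE FE.
Qed.

(** Extending maps from A to [J j] is a hypothesis because it is automatic for j > 0, where [J j] is
    injective, while for j = 0 it is the very criterion of [lifts1E]. Thus one proof serves the
    dimension shift and its start. *)
Lemma lifts_shift j : projm B ->
  (forall f : {linear A -> J j}, exists g : {linear B -> J j}, forall x, g (i x) = f x) ->
  lifts j A -> lifts j.+1 C.
Proof.
move=> hB extj lA h dh.
have [|F FE] := @lifts_proj j.+1 B hB (h \o p : {linear B -> J j.+2}).
  by move=> x; apply: dh.
have [|G GE] := lA (F \o i : {linear A -> J j.+1}).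
  by move=> x /=; rewrite FE /= pi linear0.
have [G' G'E] := extj G.
have [x|h' h'E] := @factor_p _ (F \- (dJ j \o G') : {linear B -> J j.+1}).
  by rewrite /= G'E GE subrr.
exists h' => y; have [x <-] := surj_p y.
by rewrite h'E /= linearB FE dJ_dJ subr0.
Qed.

Lemma lifts_shiftE j : projm B -> lifts j.+2 C <-> lifts j.+1 A.
Proof.
move=> hB; split=> [|h]; first exact/lifts_ker/lifts_proj.
by apply: lifts_shift => // f; apply: J_ext inj_i.
Qed.

Lemma lifts1E : projm B -> lifts 1 C <->
  forall f : {linear A -> J 0}, exists g : {linear B -> J 0}, forall x, g (i x) = f x.
Proof.
move=> hB; split=> [lC f|h]; first exact: lifts1_extend.
by apply: lifts_shift => //; apply: lifts0.
Qed.

End ShortExact.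

(** Dropping the first term of a resolution resolves the syzygy; the two Hom complexes then coincide
    by conversion, up to the shift of the index. *)
Lemma proj_resolution_syzygy (X : modc L) (P : proj_resolution X) :
  exists (K : modc L) (i : {linear K -> P 0}) (P' : proj_resolution K),
    short_exact i (pr_aug P) /\ forall (n : nat) (V : modc L),
    (forall f : hom (P n.+2) V, Ext_cocycle f -> Ext_coboundary f) <->
    (forall f : hom (P' n.+1) V, Ext_cocycle f -> Ext_coboundary f).
Proof.
have [K [i [inj ker]]] := fg_ker HL (pr_aug P).
have [x|a aE] := @factor_inj _ _ _ _ i (pr_diff P 0) inj.
  by apply/ker; apply/(pr_exact0 (p := P)); exists x.
have aug_surj : surj_map a.
  move=> y; have /(pr_exact0 (p := P))[x xy] : (pr_aug P : {linear P 0 -> X}) (i y) = 0.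
    by apply/ker; exists y.
  by exists x; apply: inj; rewrite aE.
have ex0 : exact_at (pr_diff P 1) a.
  move=> y; rewrite -(@pr_exactS _ _ P 0 y) -[X in _ <-> X = _]aE.
  split=> [->|]; first by rewrite linear0.
  by move=> e; apply: inj; rewrite e linear0.
exists K, i, (@ProjResolution L K (fun n => P n.+1) (fun n => pr_diff P n.+1) a
  (fun n => @pr_projective _ _ P n.+1) aug_surj ex0 (fun n => @pr_exactS _ _ P n.+1)).
split=> //; split=> //; exact: pr_aug_surj.
Qed.

(** Balancing of Ext, by dimension shifting along syzygies. In degree 1 both sides say that every
    map from the first syzygy to U extends to P 0: a cocycle on P 1 is the same as a map on the
    syzygy. In particular vanishing does not depend on the resolution. *)
Lemma Ext_lifts n (X : modc L) (P : proj_resolution X) :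
  (forall f : hom (P n.+1) (J 0 : modc L), Ext_cocycle f -> Ext_coboundary f) <->
  lifts n.+1 X.
Proof.
elim: n X P => [|n IH] X P.
  have [K [i [inj ker]]] := fg_ker HL (pr_aug P).
  have ses : short_exact i (pr_aug P) by split=> //; apply: pr_aug_surj.
  have hP : projm (P 0) by apply/projective_modc => //; apply: pr_projective.
  have [x|a aE] := @factor_inj _ _ _ _ i (pr_diff P 0) inj.
    by apply/ker; apply/(pr_exact0 (p := P)); exists x.
  have sa : surj_map a.
    move=> y; have /(pr_exact0 (p := P))[x xy] : (pr_aug P : {linear P 0 -> X}) (i y) = 0.
      by apply/ker; exists y.
    by exists x; apply: inj; rewrite aE.
  split=> [h|/(lifts1E ses hP) h f fd].
    apply/(lifts1E ses hP) => f.
    have [|g gE] := h (f \o a : {linear P 1 -> J 0}).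
      apply: lhomP => x /=.
      suff -> : a ((pr_diff P 1 : {linear P 2 -> P 1}) x) = 0 by rewrite linear0.
      apply: inj; rewrite aE linear0.
      by apply/(@pr_exactS _ _ P 0); exists x.
    exists g => y; have [x <-] := sa y; rewrite aE.
    by have := congr1 (fun k : {linear P 1 -> J 0} => k x) gE.
  have [|f' f'E] := factor_surj (f := f) sa.
    move=> x ax; have /(@pr_exactS _ _ P 0)[y <-] : (pr_diff P 0 : {linear P 1 -> P 0}) x = 0.
      by rewrite -aE ax linear0.
    exact: (congr1 (fun k : {linear P 2 -> J 0} => k y) fd).
  have [g gE] := h f'; exists g; apply: lhomP => x /=.
  by rewrite -f'E -gE aE.
have [K [i [P' [ses sh]]]] := proj_resolution_syzygy P.
have hP : projm (P 0) by apply/projective_modc => //; apply: pr_projective.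
by rewrite sh IH -(lifts_shiftE ses n hP).
Qed.

Lemma spliced_resolution (K P : nat -> modc L) (e : forall n, {linear P n -> K n})
    (i : forall n, {linear K n.+1 -> P n}) :
  (forall n, projm (P n)) -> (forall n, short_exact (i n) (e n)) ->
  exists R : proj_resolution (K 0%N), True.
Proof.
move=> hP ses.
have ex0 : exact_at (i 0%N \o e 1%N : {linear P 1%N -> P 0%N}) (e 0%N).
  have [_ ex _] := ses 0%N; have [_ _ s1] := ses 1%N => y; rewrite ex.
  split=> -[x <-]; last by exists (e 1%N x).
  by have [z <-] := s1 x; exists z.
have exS n : exact_at (i n.+1 \o e n.+2 : {linear P n.+2 -> P n.+1})
    (i n \o e n.+1 : {linear P n.+1 -> P n}).
  have [_ ex _] := ses n.+1; have [_ _ s1] := ses n.+2; have [inj _ _] := ses n => y.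
  split=> [/= iy|[x <-]] /=.
    have /ex[x <-] : e n.+1 y = 0 by apply: inj; rewrite iy linear0.
    by have [z <-] := s1 x; exists z.
  have -> : e n.+1 (i n.+1 (e n.+2 x)) = 0 by apply/ex; exists (e n.+2 x).
  exact: linear0.
have hP' n : projective_obj (P n) by apply/projective_modc.
have [_ _ surj0] := ses 0%N.
by exists (ProjResolution (pr_diff := fun n => i n \o e n.+1 : {linear P n.+1 -> P n})
  hP' surj0 ex0 exS).
Qed.

(** A free cover with its kernel is chosen once for every module, so that the syzygies arise by
    plain iteration. *)
Lemma proj_resolution_exists (X : modc L) : exists P : proj_resolution X, True.
Proof.
have step (K : fgmod L) : exists PK : {P : fgmod L & {K' : fgmod L &
    ({linear P -> K} * {linear K' -> P})%type}},
  projm (projT1 PK) /\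
  short_exact (projT2 (projT2 PK)).2 (projT2 (projT2 PK)).1.
  have [n [p sp]] := free_cover K; have [K' [i ses]] := ses_ker HL sp.
  exists (existT _ (fg_free L n) (existT _ K' (p, i))); split=> //=.
  exact: free_proj.
pose F K := sval (cid (step K)); have FP K := svalP (cid (step K)).
pose K n := iter n (fun K => projT1 (projT2 (F K))) X.
exact: (@spliced_resolution K (fun n => projT1 (F (K n)))
  (fun n => (projT2 (projT2 (F (K n)))).1) (fun n => (projT2 (projT2 (F (K n)))).2)
  (fun n => proj1 (FP (K n))) (fun n => proj2 (FP (K n)))).
Qed.

Lemma Ext_vanishesE n (X : modc L) : Ext_vanishes n.+1 X (J 0%N) <-> lifts n.+1 X.
Proof.
split=> [[P h]|h]; first exact/(Ext_lifts n P).
by have [P _] := proj_resolution_exists X; exists P; apply/Ext_lifts.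
Qed.

End Lifting.

(** * Additive functions *)

Lemma linear_pack (S : pzRingType) (M N : lmodType S) (f : M -> N) : linear f ->
  exists F : {linear M -> N}, forall x, F x = f x.
Proof.
move=> lf; pose F : {linear M -> N} := HB.pack f (GRing.isLinear.Build S M N *:%R f lf).
by exists F.
Qed.

Section AdditiveFunctions.
Variable L : pzRingType.
Hypothesis HL : forall M : lmodType L^c, fin_gen M -> bounded_chains (@submod _ M).
Implicit Types M N P K D Q A B C X Y Z T : fgmod L.

Definition additive_on (V : zmodType) (Cl : fgmod L -> Prop) (m : fgmod L -> V) : Prop :=
  forall A B C (i : {linear A -> B}) (p : {linear B -> C}),
    short_exact i p -> Cl A -> Cl B -> Cl C -> m B = m A + m C.

(** The pullback of two covers of A is an extension both of Y' by K and of Y by K', as in Schanuel's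
    lemma. *)
Lemma fibre_product A Y Y' K K' (i : {linear K -> Y}) (p : {linear Y -> A})
    (i' : {linear K' -> Y'}) (p' : {linear Y' -> A}) :
  short_exact i p -> short_exact i' p' ->
  exists Z (j : {linear K -> Z}) (q : {linear Z -> Y'})
    (j' : {linear K' -> Z}) (q' : {linear Z -> Y}),
    short_exact j q /\ short_exact j' q'.
Proof.
move=> [inj ex surj] [inj' ex' surj'].
have sZ : submod [set z : fg_prod Y Y' | p z.1 = p' z.2].
  split=> /=; first by rewrite !linear0.
    by move=> x y; rewrite !linearD => -> ->.
  by move=> a x; rewrite !linearZ => ->.
have [Z [e [inje ime]]] := fg_sub HL sZ.
have [f fE] : exists f : {linear K -> fg_prod Y Y'}, forall x, f x = (i x, 0).
  apply: linear_pack => a x y; rewrite linearP.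
  by rewrite -[RHS]/(a *: i x + i y, a *: 0 + 0 : Y') scaler0 addr0.
have [f' f'E] : exists f : {linear K' -> fg_prod Y Y'}, forall x, f x = (0, i' x).
  apply: linear_pack => a x y; rewrite linearP.
  by rewrite -[RHS]/(a *: 0 + 0 : Y, a *: i' x + i' y) scaler0 addr0.
have [q qE] : exists q : {linear Z -> Y'}, forall z, q z = (e z).2.
  by apply: linear_pack => a x y; rewrite linearP.
have [q' q'E] : exists q : {linear Z -> Y}, forall z, q z = (e z).1.
  by apply: linear_pack => a x y; rewrite linearP.
have eZ z : p (e z).1 = p' (e z).2 by apply: (proj2 (ime (e z))); exists z.
have [x|j jE] := @factor_inj _ _ _ _ e f inje.
  apply/ime; rewrite fE /= linear0; apply/ex; by exists x.
have [x|j' j'E] := @factor_inj _ _ _ _ e f' inje.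
  apply/ime; rewrite f'E /= linear0; apply/esym/ex'; by exists x.
have eq_e z z' : (e z).1 = (e z').1 -> (e z).2 = (e z').2 -> z = z'.
  move=> e1 e2; apply: inje; move: e1 e2.
  by case: (e z) => a b; case: (e z') => a' b' /= -> ->.
exists Z, j, q, j', q'; split; split.
- by move=> x y /(congr1 e); rewrite !jE !fE => -[/inj].
- move=> z; split=> [qz|[x <-]]; last by rewrite qE jE fE.
  have /ex[x xe] : p (e z).1 = 0 by rewrite eZ -qE qz linear0.
  by exists x; apply: eq_e; rewrite jE fE //= -qE qz.
- move=> y'; have [y ey] := surj (p' y').
  have /ime[z ez] : p (y, y').1 = p' (y, y').2 by [].
  by exists z; rewrite qE ez.
- by move=> x y /(congr1 e); rewrite !j'E !f'E => -[/inj'].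
- move=> z; split=> [qz|[x <-]]; last by rewrite q'E j'E f'E.
  have /ex'[x xe] : p' (e z).2 = 0 by rewrite -eZ -q'E qz linear0.
  by exists x; apply: eq_e; rewrite j'E f'E //= -q'E qz.
- move=> y; have [y' ey'] := surj' (p y).
  have /ime[z ez] : p (y, y').1 = p' (y, y').2 by [].
  by exists z; rewrite q'E ez.
Qed.

(* The value at M is m Y - m (ker (Y -> M)), for any Y in Cl mapping onto M. *)
Lemma extend_additive (V : zmodType) (Cl Cl' : fgmod L -> Prop) (m : fgmod L -> V) :
  (forall A B C (i : {linear A -> B}) (p : {linear B -> C}),
    short_exact i p -> Cl A -> Cl C -> Cl B) ->
  (forall A B C (i : {linear A -> B}) (p : {linear B -> C}),
    short_exact i p -> Cl B -> Cl' C -> Cl A) ->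
  (forall M, exists Y (p : {linear Y -> M}), Cl Y /\ surj_map p) ->
  (forall M, Cl M -> Cl' M) ->
  additive_on Cl m ->
  exists2 m' : fgmod L -> V, additive_on Cl' m' & forall M, Cl M -> m' M = m M.
Proof.
move=> extC kerC covC subC addm.
pose G M (z : V) := exists K Y (i : {linear K -> Y}) (p : {linear Y -> M}),
  [/\ short_exact i p, Cl K, Cl Y & z = m Y - m K].
have Guniq M z z' : G M z -> G M z' -> z = z'.
  move=> [K [Y [i [p [ses CK CY ->]]]]] [K' [Y' [i' [p' [ses' CK' CY' ->]]]]].
  (* Computing m Z in two ways gives m K + m Y' = m K' + m Y. *)
  have [Z [j [q [j' [q' [s s']]]]]] := fibre_product ses ses'.
  have CZ : Cl Z by apply: extC s CK CY'.
  have e : m K + m Y' = m K' + m Y.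
    by rewrite -(addm _ _ _ _ _ s) // -(addm _ _ _ _ _ s').
  by apply/eqP; rewrite subr_eq addrAC eq_sym subr_eq addrC e addrC.
pose m' M := xget 0 (G M).
have m'P M z : G M z -> m' M = z.
  by move=> h; apply: (Guniq M _ _ _ h); apply: (@xgetPex _ 0 (G M)); exists z.
exists m' => [A B C i p ses CA CB CC|M CM]; last first.
  have [Y [p [CY sp]]] := covC M; have [K [i ses]] := ses_ker HL sp.
  have CK : Cl K by apply: kerC ses CY (subC _ CM).
  rewrite (m'P M (m Y - m K)); first by rewrite (addm _ _ _ _ _ ses) // addrC addKr.
  by exists K, Y, i, p.
(* One cover Y of B serves all three terms: with KB and KC the kernels of Y -> B and Y -> C, the
   module KC covers A with kernel KB, and m Y - m KB is the sum of m KC - m KB and m Y - m KC. *)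
have [Y [q [CY sq]]] := covC B.
have [KB [iB sB]] := ses_ker HL sq.
have [inj ex surj] := ses.
have sqp : surj_map (p \o q : {linear Y -> C}).
  by move=> c; have [b <-] := surj c; have [y <-] := sq b; exists y.
have [KC [iC sC]] := ses_ker HL sqp.
have CKB : Cl KB by apply: kerC sB CY CB.
have CKC : Cl KC by apply: kerC sC CY CC.
have [injB exB _] := sB; have [injC exC _] := sC.
have [x|j jE] := @factor_inj _ _ _ _ iC iB injC.
  apply/exC => /=; have -> : q (iB x) = 0 by apply/exB; exists x.
  exact: linear0.
have [x|a aE] := @factor_inj _ _ _ _ i (q \o iC : {linear KC -> B}) inj.
  by apply/ex; apply: (proj2 (exC (iC x))); exists x.
have sA : short_exact j a.
  split.
  - by move=> x y /(congr1 iC); rewrite !jE => /injB.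
  - move=> x; split=> [ax|[y <-]].
      have /exB[y yx] : q (iC x) = 0 by rewrite -[LHS](aE x) ax linear0.
      by exists y; apply: injC; rewrite jE.
    by apply: inj; rewrite aE /= jE linear0; apply/exB; exists y.
  - move=> y; have [z zy] := sq (i y).
    have /exC[x xz] : (p \o q : {linear Y -> C}) z = 0 by rewrite /= zy; apply/ex; exists y.
    by exists x; apply: inj; rewrite aE /= xz.
rewrite (m'P B (m Y - m KB)); last by exists KB, Y, iB, q.
rewrite (m'P C (m Y - m KC)); last by exists KC, Y, iC, (p \o q : {linear Y -> C}).
rewrite (m'P A (m KC - m KB)); last by exists KB, KC, j, a.
by rewrite [RHS]addrC addrA subrK.
Qed.

Section Expansion.
Variables (V : lmodType rat) (m : fgmod L -> V).
Hypothesis addm : additive_on (fun=> True) m.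

Lemma additive0 M : (forall x : M, x = 0) -> m M = 0.
Proof.
move=> M0.
have ses : short_exact (idfun : {linear M -> M}) (idfun : {linear M -> M}).
  split=> [x y //|y|y]; last by exists y.
  by split=> _; [exists y|apply: M0].
have /eqP := addm ses I I I.
by rewrite -{1}(addr0 (m M)) (inj_eq (addrI _)) eq_sym => /eqP.
Qed.

Lemma additive_iso M N (f : {linear M -> N}) :
  injective f -> surj_map f -> m M = m N.
Proof.
move=> inj surj; have [Z [p [ses Z0]]] := ses_iso inj surj.
by rewrite (addm ses I I I) (additive0 Z0) addr0.
Qed.

(** Both sides are additive, so induction on length by splitting off a simple quotient reduces to
    the [T j]. There the sum has one nonzero term, and dividing by the positive diagonal
    multiplicity fixes the coefficient. *)
Lemma additive_expansion d (P : 'I_d -> modc L) (T : 'I_d -> fgmod L) :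
  (forall k, projm (P k)) ->
  (forall T', smod T' -> exists k (f : {linear T' -> T k}), injective f /\ surj_map f) ->
  (forall j k, (0 < mult (P j) (T k))%N = (j == k)) ->
  exists l : 'I_d -> V, forall M, m M = \sum_j (mult (P j) M)%:R *: l j.
Proof.
move=> hP hT dual.
exists (fun j => (mult (P j) (T j))%:R^-1 *: m (T j)) => M.
have [n] := ubnP (len M); elim: n M => // n IH M lM.
have [M0|nM0] := pselect (forall x : M, x = 0).
  rewrite additive0 // big1 // => j _.
  by rewrite (mult0 HL (P j) M0) scale0r.
have [|T' [p [sp sT']]] := simple_quot HL (M := M).
  by apply: contrapT => nx; apply: nM0 => x; apply: contrapT => xn0; apply: nx; exists x.
have [K [i ses]] := ses_ker HL sp.
have lK : (len K < n)%N.
  have T'0 : (0 < len T')%N by apply/(len_gt0 HL); case: sT'.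
  rewrite ltnS (len_add HL ses) in lM; apply: leq_trans lM.
  by rewrite -addn1 leq_add2l.
rewrite (addm ses I I I) (IH K lK).
have -> : m T' = \sum_j (mult (P j) T')%:R *: ((mult (P j) (T j))%:R^-1 *: m (T j)).
  have [k [f [injf surjf]]] := hT T' sT'.
  rewrite (additive_iso injf surjf) (bigD1 k) //= big1 ?addr0 => [|j jk].
    rewrite (mult_iso HL (hP k) injf surjf) scalerA mulfV ?scale1r //.
    by rewrite pnatr_eq0 -lt0n dual.
  rewrite (mult_iso HL (hP j) injf surjf).
  have := dual j k; rewrite (negPf jk) lt0n => /negbFE/eqP ->.
  by rewrite scale0r.
rewrite -big_split; apply: eq_bigr => j _ /=.
by rewrite -scalerDl -natrD (mult_add HL (hP j) ses).
Qed.

End Expansion.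
End AdditiveFunctions.

(** * Composition series *)

(** Labelling each element by the position of the first member of [s] related to it turns equality
    of counts into [perm_eq] for lists of numbers. *)
Lemma matching_permutation (X : Type) (r : X -> X -> Prop) (x0 : X) (s t : seq X) :
  (forall x, r x x) -> (forall x y, r x y -> r y x) ->
  (forall x y z, r x y -> r y z -> r x z) ->
  (forall x, count (fun y => `[< r x y >]) s = count (fun y => `[< r x y >]) t) ->
  size t = size s /\
  exists p : 'S_(size s), forall i : 'I_(size s), r (nth x0 s i) (nth x0 t (p i)).
Proof.
move=> rr rs rt cnt.
pose lab x := find (fun y => `[< r x y >]) s.
have lab_r x y : r x y -> lab x = lab y.
  move=> rxy; apply: eq_find => z; apply: asbool_equiv_eq.
  by split; apply: rt => //; apply: rs.
have labP x : has (fun y => `[< r x y >]) s -> r x (nth x0 s (lab x)).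
  by move/(nth_find x0)/asboolP.
have cnt_lab k : count_mem k (map lab s) = count_mem k (map lab t).
  rewrite !count_map.
  have [[x [hx ek]]|nk] := pselect (exists x, has (fun y => `[< r x y >]) s /\ lab x = k).
    have e u : count (preim lab (pred1 k)) u = count (fun y => `[< r x y >]) u.
      apply: eq_count => y /=; apply/eqP/asboolP => [ey|/lab_r <- //].
      have := labP x hx; rewrite ek -ey => rx; apply: (rt _ _ _ rx); apply: rs.
      by apply: labP; rewrite has_find -/(lab y) ey -ek -has_find.
    by rewrite !e.
  (* A label [k] not attained by an element related to a member of [s] occurs in neither list, since
     equal counts relate every member of [t] to some member of [s]. *)
  have zero u : (forall x, (0 < count (fun y => `[< r x y >]) u)%N ->
      has (fun y => `[< r x y >]) s) -> count (preim lab (pred1 k)) u = 0%N.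
    move=> hu; apply/eqP; rewrite -leqn0 leqNgt -has_count.
    apply/negP => /(has_nthP x0)[i iu /eqP ek]; apply: nk; exists (nth x0 u i).
    split=> //; apply: hu; rewrite -has_count; apply/(has_nthP x0); exists i => //.
    exact/asboolP.
  rewrite !zero // => x; first by rewrite -cnt -has_count.
  by rewrite -has_count.
have perm_lab : perm_eq (map lab s) (map lab t) by apply/allP => k _; apply/eqP.
have st : size t = size s by have := perm_size perm_lab; rewrite !size_map.
split=> //; have szt : size (map lab t) == size s by rewrite size_map st.
have /(@tuple_permP _ _ _ (Tuple szt))[p e] := perm_lab.
exists p => i.
have /(congr1 (fun u => nth 0%N u i)) := e.
rewrite (nth_map x0) // -tnth_nth tnth_mktuple (tnth_nth 0%N) /= (nth_map x0) ?st //.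
move=> ei; have hs : has (fun y => `[< r (nth x0 s i) y >]) s.
  by apply/(has_nthP x0); exists i => //; apply/asboolP.
apply: (rt _ _ _ (labP _ hs)); apply: rs; rewrite ei; apply: labP.
by rewrite has_find -/(lab _) -ei -has_find.
Qed.

Lemma fmor0 (C C' : preexact) (A : exact_functor C C') (X Y : C) :
  fmor A (0 : hom X Y) = 0.
Proof. by apply: (addrI (fmor A 0)); rewrite -fmorD !addr0. Qed.

(** * Simple filtrations and composition series in an embedded exact category *)

Section Embedding.
Variable L : pzRingType.
Hypothesis HL : forall M : lmodType L^c, fin_gen M -> bounded_chains (@submod _ M).
Variables (E : preexact) (HE : is_exact E) (D : exact_functor E (modc L)).
Hypothesis Dfaithful : forall (X Y : E) (f : hom X Y), fmor D f = 0 -> f = 0.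
Hypothesis Dfull : forall (X Y : E) (g : hom (D X) (D Y)), exists f, fmor D f = g.
Hypothesis Dreflect : forall (X Y Z : E) (f : hom X Y) (g : hom Y Z),
  conflation (fmor D f) (fmor D g) -> conflation f g.
Implicit Types X Y Z W Q S : E.

Definition dm X Y (f : hom X Y) : {linear D X -> D Y} := fmor D f.

Lemma dm_comp X Y Z (g : hom Y Z) (f : hom X Y) x : dm (g ∘ f) x = dm g (dm f x).
Proof. by rewrite /dm fmor_comp. Qed.

Lemma dm_id X x : dm (idm X) x = x.
Proof. by rewrite /dm fmor_id. Qed.

Lemma dm_add X Y (f g : hom X Y) x : dm (f + g) x = dm f x + dm g x.
Proof. by rewrite /dm fmorD. Qed.

Lemma dm0 X Y x : dm (0 : hom X Y) x = 0.
Proof. by rewrite /dm fmor0. Qed.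

Lemma dm_inj X Y (f g : hom X Y) : (forall x, dm f x = dm g x) -> f = g.
Proof.
move=> fg; apply/eqP; rewrite -subr_eq0; apply/eqP/Dfaithful.
have e : fmor D (f - g) + fmor D g = fmor D g.
  by rewrite -fmorD subrK; apply: lhomP.
by apply: (addIr (fmor D g)); rewrite e add0r.
Qed.

Lemma dm_full X Y (g : {linear D X -> D Y}) : exists f, forall x, dm f x = g x.
Proof. by have [f fE] := Dfull (g : hom (D X) (D Y)); exists f => x; rewrite /dm fE. Qed.

Lemma dm_conflation X Y Z (f : hom X Y) (g : hom Y Z) :
  conflation f g <-> short_exact (dm f) (dm g).
Proof. by split=> [/(fmor_conflation D)|h]; last exact: Dreflect. Qed.

Lemma dm_zero X : zero_obj X <-> forall x : D X, x = 0.
Proof.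
split=> [[h _] x|h].
  have e : idm X = idm X + idm X by rewrite (h X (idm X)) addr0.
  have : dm (idm X) x = dm (idm X) x + dm (idm X) x by rewrite {1}e /dm fmorD.
  by rewrite dm_id -{1}(addr0 x) => /addrI.
have e X' (f g : hom X X') : f = g.
  by apply: dm_inj => x; rewrite (h x) !linear0.
have e' X' (f g : hom X' X) : f = g.
  by apply: dm_inj => x; rewrite (h (dm f x)) (h (dm g x)).
by split=> Y f; [apply: e|apply: e'].
Qed.

Lemma dm_iso X Y (f : hom X Y) : iso_mor f <-> injective (dm f) /\ surj_map (dm f).
Proof.
split=> [[g gf fg]|[inj surj]].
  split=> [x y e|y].
    by rewrite -(dm_id x) -(dm_id y) -gf !dm_comp e.
  by exists (dm g y); rewrite -dm_comp fg dm_id.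
have [y|g' g'E] := @factor_inj _ _ _ _ (dm f) idfun inj; first exact: surj.
have [g gE] := dm_full g'; exists g; apply: dm_inj => x; rewrite dm_comp dm_id gE.
  by apply: inj; rewrite g'E.
by rewrite g'E.
Qed.

Lemma dm_isomorphic X Y : isomorphic X Y <-> @isomorphic (modc L) (D X) (D Y).
Proof.
rewrite isomorphic_modc; split=> [[f /dm_iso fi]|[g gi]]; first by exists (dm f).
have [f fE] := dm_full g; exists f; apply/dm_iso.
have [inj surj] := gi; split=> [x y|y]; first by rewrite !fE => /inj.
by have [x <-] := surj y; exists x.
Qed.

Definition lenE X : nat := len (D X).

Lemma lenE_add X Y Z (f : hom X Y) (g : hom Y Z) :
  conflation f g -> lenE Y = (lenE X + lenE Z)%N.
Proof. by move/dm_conflation/(len_add HL). Qed.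

Lemma lenE_eq0 X : lenE X = 0%N <-> zero_obj X.
Proof. by rewrite /lenE (len_eq0 HL) dm_zero. Qed.

Lemma inflation_inj X Y (f : hom X Y) : inflation f -> injective (dm f).
Proof. by move=> [Z [g /dm_conflation[]]]. Qed.

Lemma inflation_iso X Y (f : hom X Y) : inflation f -> (lenE Y <= lenE X)%N -> iso_mor f.
Proof.
move=> /inflation_inj inj l; apply/dm_iso; split=> //; exact: len_inj_surj.
Qed.

Lemma lenE_inflation X Y (f : hom X Y) : inflation f -> (lenE X <= lenE Y)%N.
Proof. by move/inflation_inj/(len_inj HL). Qed.

Lemma lenE_iso X Y : isomorphic X Y -> lenE X = lenE Y.
Proof.
move=> [f /dm_iso[inj surj]]; apply/eqP; rewrite eqn_leq (len_inj HL inj).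
exact: len_surj surj.
Qed.

Lemma conflation_factor X Y Z W (f : hom X Y) (g : hom Y Z) (h : hom W Y) :
  conflation f g -> (forall x, dm g (dm h x) = 0) -> exists k, f ∘ k = h.
Proof.
move=> /(conflation_ker HE)[_ ker] gh.
have [|k [fk _]] := ker W h; last by exists k.
by apply: dm_inj => x; rewrite dm_comp gh dm0.
Qed.

Lemma conflation_isom X Y Z Y' (f : hom X Y) (g : hom Y Z) (a : hom Y Y')
    (b : hom Y' Y) : b ∘ a = idm Y -> a ∘ b = idm Y' ->
  conflation f g -> conflation (a ∘ f) (g ∘ b).
Proof.
move=> ba ab; apply: (conflation_iso HE (a := idm X) (b := a) (c := idm Z)).
- by exists (idm X); rewrite comp1m.
- by exists b.
- by exists (idm Z); rewrite comp1m.
- by rewrite compm1.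
- by rewrite comp1m -compA ba compm1.
Qed.

Lemma iso_inflation X Y (f : hom X Y) : iso_mor f -> inflation f.
Proof.
move=> [g gf fg]; have [Z [p c]] := inflation_id HE X.
by exists Z, (p ∘ g); rewrite -(compm1 f); apply: conflation_isom.
Qed.

(** Y' is the preimage of Z' in Y. It exists in E because deflations compose; exactness of X -> Y'
    -> Z' is checked on modules and reflected. *)
Lemma conflation_preimage X Y Z Z' S (f : hom X Y) (g : hom Y Z)
    (h : hom Z' Z) (k : hom Z S) :
  conflation f g -> conflation h k ->
  exists Y' (u : hom Y' Y) (f' : hom X Y') (g' : hom Y' Z'),
    [/\ conflation u (k ∘ g), conflation f' g' & u ∘ f' = f].
Proof.
move=> cfg chk.
have [Y' [u cu]] : deflation (k ∘ g).
  by apply: (deflation_comp HE); [exists X, f|exists Z', h].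
have /dm_conflation[injf exf surjg] := cfg.
have /dm_conflation[injh exh surjk] := chk.
have /dm_conflation[inju exu surju] := cu.
have [x|f' uf'] := conflation_factor (h := f) cu.
  rewrite dm_comp; have -> : dm g (dm f x) = 0 by apply/exf; exists x.
  exact: linear0.
have [x|g' hg'] := conflation_factor (h := g ∘ u) chk.
  by rewrite dm_comp -dm_comp; apply/exu; exists x.
exists Y', u, f', g'; split=> //; apply/dm_conflation.
have uf x : dm u (dm f' x) = dm f x by rewrite -dm_comp uf'.
have hg x : dm h (dm g' x) = dm g (dm u x) by rewrite -!dm_comp hg'.
split.
- by move=> x y /(congr1 (dm u)); rewrite !uf => /injf.
- move=> y; split=> [gy|[x <-]].
    have /exf[x xE] : dm g (dm u y) = 0 by rewrite -hg gy linear0.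
    by exists x; apply: inju; rewrite uf.
  by apply: injh; rewrite hg uf linear0; apply/exf; exists x.
- move=> z; have [y yz] := surjg (dm h z).
  have /exu[y' y'y] : dm (k ∘ g) y = 0 by rewrite dm_comp yz; apply/exh; exists z.
  by exists y'; apply: injh; rewrite hg y'y.
Qed.

(** The sequence B/A -> C/A -> C/B. Its outer terms lie in E since [a] and [b] are inflations, and
    its exactness is reflected from modules. *)
Lemma conflation_third A B C Q (f : hom A C) (g : hom C Q) (a : hom A B) (b : hom B C) :
  conflation f g -> inflation a -> inflation b -> b ∘ a = f ->
  exists Z N (l : hom B Z) (n : hom C N) (s : hom Z Q) (t : hom Q N),
    [/\ conflation a l, conflation b n & conflation s t].
Proof.
move=> cfg [Z [l cal]] [N [n cbn]] ba; exists Z, N, l, n.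
have /dm_conflation[injf exf surjg] := cfg.
have /dm_conflation[inja exa surjl] := cal.
have /dm_conflation[injb exb surjn] := cbn.
have baE x : dm b (dm a x) = dm f x by rewrite -dm_comp ba.
have [x|s' s'E] := @factor_surj _ _ _ _ (dm l) (dm g \o dm b : {linear D B -> D Q}) surjl.
  by move=> /exa[y <-] /=; rewrite baE; apply/exf; exists y.
have [x|t' t'E] := @factor_surj _ _ _ _ (dm g) (dm n) surjg.
  by move=> /exf[y <-]; rewrite -baE; apply/exb; exists (dm a y).
have [s sE] := dm_full s'; have [t tE] := dm_full t'.
exists s, t; split=> //; apply/dm_conflation; split.
- apply: injP => z; rewrite sE; have [x <-] := surjl z.
  rewrite s'E => /= /exf[y]; rewrite -baE => /injb <-.
  by apply/exa; exists y.
- move=> q; rewrite tE; have [c <-] := surjg q; rewrite t'E; split=> [/exb[x <-]|[z]].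
    by exists (dm l x); rewrite sE s'E.
  have [x <-] := surjl z; rewrite sE s'E /= => /eqP.
  rewrite eq_sym -subr_eq0 -linearB => /eqP/exf[y yE].
  apply/exb; exists (dm a y + x); rewrite linearD baE yE subrK.
  by [].
- by move=> m; have [c <-] := surjn m; exists (dm g c); rewrite tE t'E.
Qed.

Lemma simple_conflation X Y Z (f : hom X Y) (g : hom Y Z) :
  simple_obj Y -> conflation f g -> zero_obj X \/ zero_obj Z.
Proof.
move=> [_ nex] cfg; have [zX|nzX] := pselect (zero_obj X); first by left.
by right; apply: contrapT => nzZ; apply: nex; exists X, Z, f, g.
Qed.

Lemma simple_iso X Y : isomorphic X Y -> simple_obj X -> simple_obj Y.
Proof.
move=> [a [b ba ab]] [nzX nex]; split.
  have e : lenE X = lenE Y by apply: lenE_iso; exists a, b.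
  by move/lenE_eq0; rewrite -e => /lenE_eq0.
move=> [U [N [i [p [cip nU nN]]]]]; apply: nex; exists U, N, (b ∘ i), (p ∘ a).
by split=> //; apply: conflation_isom.
Qed.

(* The simple factors are listed from bottom to top. *)
Inductive filt : E -> seq E -> Prop :=
| filt0 X : zero_obj X -> filt X [::]
| filtS X Y S s (f : hom X Y) (g : hom Y S) :
    conflation f g -> simple_obj S -> filt X s -> filt Y (rcons s S).

Lemma filt_iso X Y s : isomorphic X Y -> filt X s -> filt Y s.
Proof.
move=> XY fX; have [a [b ba ab]] := XY; case: fX a b ba ab XY.
  move=> Z zZ a b _ _ /lenE_iso e; apply: filt0; apply/lenE_eq0; rewrite -e.
  exact/lenE_eq0.
move=> X' Z S s' f g cfg sS fX' a b ba ab _.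
exact: filtS (conflation_isom ba ab cfg) sS fX'.
Qed.

(** Induction on the filtration of Z: its top factor is also the top factor of Y, over the preimage
    in Y of the rest of Z. *)
Lemma filt_cat X Y Z (f : hom X Y) (g : hom Y Z) s t :
  conflation f g -> filt X s -> filt Z t -> filt Y (s ++ t).
Proof.
move=> cfg fX fZ; elim: fZ Y f g cfg => {Z t} [Z zZ|Z' Z S t h k chk sS fZ' IH] Y f g cfg.
  rewrite cats0; apply: filt_iso fX; exists f; apply: inflation_iso; first by exists Z, g.
  by rewrite (lenE_add cfg) (proj2 (lenE_eq0 Z) zZ) addn0.
have [Y' [u [f' [g' [cu cf' uf']]]]] := conflation_preimage cfg chk.
by rewrite -rcons_cat; apply: filtS cu sS (IH _ _ _ cf').
Qed.

Lemma filt_simple S : simple_obj S -> filt S [:: S].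
Proof.
move=> sS; have [K [i ci]] := deflation_id HE S.
apply: (filtS (s := [::]) ci sS); apply: filt0; apply/lenE_eq0/eqP.
by have /eqP := lenE_add ci; rewrite -{1}(add0n (lenE S)) eqn_add2r eq_sym.
Qed.

Lemma filt_exists X : exists s, filt X s.
Proof.
have [n] := ubnP (lenE X); elim: n X => // n IH X lX.
have [zX|nzX] := pselect (zero_obj X); first by exists [::]; apply: filt0.
have [sX|nsX] := pselect (simple_obj X); first by exists [:: X]; apply: filt_simple.
have [A [B [i [p [cip nA nB]]]]] : exists (A B : E) (i : hom A X) (p : hom X B),
    [/\ conflation i p, ~ zero_obj A & ~ zero_obj B].
  by apply: contrapT => nex; apply: nsX.
have pos (Y : E) : ~ zero_obj Y -> (0 < lenE Y)%N.
  by move=> nY; rewrite lt0n; apply/eqP => /lenE_eq0.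
have e := lenE_add cip; rewrite e ltnS in lX.
have [|s fA] := IH A.
  by apply: leq_trans lX; rewrite -addn1 leq_add2l pos.
have [|t fB] := IH B.
  by apply: leq_trans lX; rewrite -add1n leq_add2r pos.
by exists (s ++ t); apply: filt_cat cip fA fB.
Qed.

Section Subobjects.
Variable X : E.
Implicit Types A B C : subobj X.

Lemma sub_le_trans A B C : sub_le A B -> sub_le B C -> sub_le A C.
Proof.
move=> [f inff fE] [g infg gE]; exists (g ∘ f); first exact: (inflation_comp HE).
by rewrite compA gE.
Qed.

Lemma sub_le_len A B : sub_le A B -> (lenE A <= lenE B)%N.
Proof. by move=> [f /lenE_inflation]. Qed.

Lemma sub_eq_len A B : sub_eq A B -> lenE A = lenE B.
Proof. by move=> [f fi _]; apply: lenE_iso; exists f. Qed.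

Lemma sub_eq_sym A B : sub_eq A B -> sub_eq B A.
Proof.
move=> [f [g gf fg] fE]; exists g; first by exists f.
by rewrite -fE -compA fg compm1.
Qed.

Lemma sub_le_eq A B : sub_le A B -> (lenE B <= lenE A)%N -> sub_eq A B.
Proof. by move=> [f inff fE] l; exists f => //; apply: inflation_iso. Qed.

Lemma sub_le_refl A : sub_le A A.
Proof. by exists (idm A); [apply: (inflation_id HE)|rewrite compm1]. Qed.

Lemma sub_map_mono A W (f g : hom W A) : sub_map A ∘ f = sub_map A ∘ g -> f = g.
Proof.
move=> e; apply: dm_inj => x; apply: (inflation_inj (sub_mapP A)).
by rewrite -!dm_comp e.
Qed.

Lemma sub_quotient_le A B Q : sub_quotient A B Q -> sub_le A B.
Proof. by move=> [f [p [fE c]]]; exists f => //; exists Q, p. Qed.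

Lemma sub_quotient_len A B Q : sub_quotient A B Q -> lenE B = (lenE A + lenE Q)%N.
Proof. by move=> [f [p [fE c]]]; apply: lenE_add c. Qed.

Lemma sub_quotient_unique A B Q Q' :
  sub_quotient A B Q -> sub_quotient A B Q' -> isomorphic Q Q'.
Proof.
move=> [f [p [fE c]]] [f' [p' [fE' c']]].
have e : f' = f by apply: sub_map_mono; rewrite fE.
rewrite e in c'.
have [pf coker] := conflation_coker HE c; have [pf' coker'] := conflation_coker HE c'.
have [a [ap _]] := coker _ _ pf'; have [b [bp _]] := coker' _ _ pf.
have epi (Z Y W : E) (q : hom Y Z) (u v : hom Z W) : surj_map (dm q) -> u ∘ q = v ∘ q -> u = v.
  by move=> sq uv; apply: dm_inj => z; have [y <-] := sq z; rewrite -!dm_comp uv.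
have /dm_conflation[_ _ sp] := c; have /dm_conflation[_ _ sp'] := c'.
exists a, b.
  by apply: epi sp _; rewrite -compA ap bp comp1m.
by apply: epi sp' _; rewrite -compA bp ap comp1m.
Qed.

Lemma chain_le n (c : nat -> subobj X) : (forall i, (i < n)%N -> sub_le (c i) (c i.+1)) ->
  forall i j, (i <= j <= n)%N -> sub_le (c i) (c j).
Proof.
move=> h i j; elim: j => [|j IH]; first by rewrite leqn0 => /andP[/eqP -> _]; apply: sub_le_refl.
rewrite leq_eqVlt => /andP[/orP[/eqP -> _|ij jn]]; first exact: sub_le_refl.
by apply: sub_le_trans (h j jn); apply: IH; rewrite -ltnS ij ltnW.
Qed.

(** A proper nonzero admissible subobject of the factor has a preimage strictly between two
    neighbours of the chain. It is comparable with every member, so maximality makes it equal to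
    one, against its length. *)
Lemma composition_factor_simple n (c : nat -> subobj X) i Q :
  composition_series n c -> (i < n)%N -> sub_quotient (c i) (c i.+1) Q -> simple_obj Q.
Proof.
move=> [_ _ lt_c max_c] lt_in sq; have [f [p [fE cfp]]] := sq.
have [_ ne] := lt_c i lt_in.
split=> [/lenE_eq0 zQ|].
  apply: ne; apply: sub_le_eq (sub_quotient_le sq) _.
  by rewrite (sub_quotient_len sq) zQ addn0.
move=> [A [N [h [k [chk nA nN]]]]].
have [B [u [f' [g' [cu cf' uf']]]]] := conflation_preimage cfp chk.
have infu : inflation u by exists N, (k ∘ p).
pose b := Subobj (inflation_comp HE infu (sub_mapP (c i.+1))).
have le1 : sub_le (c i) b.
  by exists f' => /=; [exists A, g'|rewrite -compA uf'].
have le2 : sub_le b (c i.+1) by exists u.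
have pos (Y : E) : ~ zero_obj Y -> (0 < lenE Y)%N.
  by move=> nY; rewrite lt0n; apply/eqP => /lenE_eq0.
have lt1 : (lenE (c i) < lenE b)%N.
  by rewrite /= (lenE_add cf') -{1}(addn0 (lenE (c i))) ltn_add2l pos.
have lt2 : (lenE b < lenE (c i.+1))%N.
  by rewrite /= (lenE_add cu) -{1}(addn0 (lenE B)) ltn_add2l pos.
have le_c := chain_le (fun j jn => proj1 (lt_c j jn)).
have [j jn|j jn /sub_eq_len ej] := max_c b.
  have [ji|ij] := leqP j i.
    by right; apply: sub_le_trans le1; apply: le_c; rewrite ji ltnW.
  by left; apply: sub_le_trans le2 _; apply: le_c; rewrite ij.
have [ji|ij] := leqP j i.
  have /sub_le_len : sub_le (c j) (c i) by apply: le_c; rewrite ji ltnW.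
  by rewrite -ej leqNgt lt1.
have /sub_le_len : sub_le (c i.+1) (c j) by apply: le_c; rewrite ij.
by rewrite -ej leqNgt lt2.
Qed.

(** Maximality: descending the chain, an element comparable with all members either falls below the
    next one or sits between two neighbours, where it cuts their simple quotient by a conflation and
    so equals one of them. *)
Lemma simple_chain_composition n (c : nat -> subobj X) :
  zero_obj (c 0%N) -> iso_mor (sub_map (c n)) ->
  (forall i, (i < n)%N -> exists2 Q, simple_obj Q & sub_quotient (c i) (c i.+1) Q) ->
  composition_series n c.
Proof.
move=> z0 isoX sc; split=> // [i lt_in|B cmp].
  have [Q [nz _] sq] := sc i lt_in; split; first exact: sub_quotient_le sq.
  move/sub_eq_len => e; apply: nz; apply/lenE_eq0/eqP.
  by have /eqP := sub_quotient_len sq; rewrite -e -{1}(addn0 (lenE (c i))) eqn_add2l eq_sym.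
(* The top of the chain represents X itself, so B lies below it even when the comparison is given
   the other way round. *)
have Bn : sub_le B (c n).
  have [//|le_nB] := cmp n (leqnn n).
  have /sub_eq_sym[f fi fE] : sub_eq (c n) B.
    apply: sub_le_eq le_nB _; have <- : lenE X = lenE (c n).
      by apply/esym/lenE_iso; exists (sub_map (c n)).
    exact: lenE_inflation (sub_mapP B).
  by exists f => //; apply: iso_inflation.
have zero_le (A : subobj X) : sub_le A (c 0%N) -> sub_eq A (c 0%N).
  by move=> le0; apply: sub_le_eq => //; rewrite (proj2 (lenE_eq0 (c 0%N)) z0).
elim: n Bn {isoX} sc cmp => [|n IH] Bn sc cmp; first by exists 0%N => //; apply: zero_le.
have [B'n|nB'n] := pselect (sub_le B (c n)).
  have [||i lin eqi] := IH B'n.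
  - by move=> i lin; apply: sc; apply: leqW.
  - by move=> i lin; apply: cmp; apply: leqW.
  by exists i => //; apply: leqW.
have nB : sub_le (c n) B by have [] := cmp n (leqnSn n).
have [Q sQ [f [p [fE cfp]]]] := sc n (ltnSn n).
have [a infa aE] := nB; have [b infb bE] := Bn.
have ba : b ∘ a = f by apply: sub_map_mono; rewrite compA bE aE fE.
have [Z [N [l [m [s [t [cal cbm cst]]]]]]] := conflation_third cfp infa infb ba.
have [zZ|zN] := simple_conflation sQ cst.
  exists n; first exact: leqnSn.
  apply: sub_eq_sym; apply: sub_le_eq nB _.
  by rewrite (lenE_add cal) (proj2 (lenE_eq0 Z) zZ) addn0.
exists n.+1 => //; apply: sub_le_eq Bn _.
by rewrite (lenE_add cbm) (proj2 (lenE_eq0 N) zN) addn0.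
Qed.

End Subobjects.

Lemma filt_series X s : filt X s -> exists2 c : nat -> subobj X,
  composition_series (size s) c &
  forall i, (i < size s)%N -> sub_quotient (c i) (c i.+1) (nth X s i).
Proof.
move=> fX; suff [c [z0 isoX sc simc]] : exists c : nat -> subobj X,
    [/\ zero_obj (c 0%N), iso_mor (sub_map (c (size s))),
      forall i, (i < size s)%N -> sub_quotient (c i) (c i.+1) (nth X s i) &
      forall i, (i < size s)%N -> simple_obj (nth X s i)].
  exists c => //; apply: simple_chain_composition => // i lis.
  by exists (nth X s i); [apply: simc|apply: sc].
have isoid Y : iso_mor (idm Y) by exists (idm Y); rewrite comp1m.
elim: fX => {X s} [X zX|X Y S s f g cfg sS fX [c [z0 isoX sc simc]]].
  by exists (fun=> Subobj (inflation_id HE X)).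
have inff : inflation f by exists S, g.
pose up (A : subobj X) := Subobj (inflation_comp HE (sub_mapP A) inff).
(* The chain of X is pushed into Y along [f], and Y itself is added on top. *)
pose d i := if (i <= size s)%N then up (c i) else Subobj (inflation_id HE Y).
have d_le i : (i <= size s)%N -> d i = up (c i) by rewrite /d => ->.
have d_last : d (size s).+1 = Subobj (inflation_id HE Y) by rewrite /d ltnn.
exists d; rewrite size_rcons; split=> [|||i].
- by rewrite d_le.
- by rewrite d_last.
- move=> i; rewrite ltnS leq_eqVlt => /orP[/eqP ->|lis].
    (* The top of the old chain is only isomorphic to X, so the conflation with quotient S is
       transported along the inverse [n]. *)
    rewrite d_last d_le // nth_rcons ltnn eqxx; have [n nm mn] := isoX.
    exists (f ∘ sub_map (c (size s))), g; split; first by rewrite /= comp1m.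
    apply: (conflation_iso HE (a := n) (b := idm Y) (c := idm S)) cfg => //.
    + by exists (sub_map (c (size s))).
    + by rewrite comp1m -compA mn compm1.
    + by rewrite comp1m compm1.
  rewrite !d_le ?(ltnW lis) // nth_rcons lis (set_nth_default X) //.
  have [h [p [hE chp]]] := sc i lis; exists h, p; split=> //=.
  by rewrite -compA hE.
- rewrite ltnS nth_rcons => lis; case: ltngtP lis => // lis _.
  by rewrite (set_nth_default X) //; apply: simc.
Qed.

Lemma series_filt X n (c : nat -> subobj X) : composition_series n c ->
  exists2 s, size s = n & filt X s /\
    forall i, (i < n)%N -> sub_quotient (c i) (c i.+1) (nth X s i).
Proof.
move=> cs; have [z0 isoX lt_c _] := cs.
have /choice[q qP] i : exists Q, (i < n)%N -> sub_quotient (c i) (c i.+1) Q.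
  have [lt_in|ge] := ltnP i n; last by exists X.
  by have [[f [Q [p cfp]] fE] _] := lt_c i lt_in; exists Q => _; exists f, p.
exists (mkseq q n); first exact: size_mkseq.
split=> [|i lt_in]; last by rewrite nth_mkseq //; apply: qP.
suff h i : (i <= n)%N -> filt (c i) (mkseq q i).
  by apply: filt_iso (h n (leqnn n)); exists (sub_map (c n)).
elim: i => [_|i IH lt_in]; first exact: filt0.
rewrite mkseqS; have sq := qP i lt_in.
have [f [p [_ cfp]]] := sq.
exact: filtS cfp (composition_factor_simple cs lt_in sq) (IH (ltnW lt_in)).
Qed.

Definition multiplicity (Q : E) (s : seq E) : nat := count (fun S => `[< isomorphic Q S >]) s.

(** (JHP) with permutations traded for multiplicities, which add up when filtrations are
    concatenated. *)
Definition filt_unique : Prop := forall X s t, filt X s -> filt X t ->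
  forall Q, multiplicity Q s = multiplicity Q t.

Lemma JHP_filt_unique : JHP E <-> filt_unique.
Proof.
split=> [jhp X s t fs ft Q|uniq X n m c d cc cd].
  have [c cc cQ] := filt_series fs; have [d cd dQ] := filt_series ft.
  have [st [sg sgP]] := jhp X _ _ c d cc cd.
  have multE (u : seq E) k : size u = k ->
      multiplicity Q u = (\sum_(i < k) `[< isomorphic Q (nth X u i) >])%N.
    move=> <-; rewrite /multiplicity -sum1_count (big_nth X) big_mkord.
    by rewrite big_mkcond; apply: eq_bigr => i _; case: ifP.
  rewrite (multE s _ erefl) (multE t _ st) [RHS](reindex_inj (@perm_inj _ sg)).
  apply: eq_bigr => i _; congr nat_of_bool; apply: asbool_equiv_eq.
  have [Q1 [Q2 [sq1 sq2 e12]]] := sgP i.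
  have e1 := sub_quotient_unique (cQ i (ltn_ord i)) sq1.
  have lt_st : (sg i < size t)%N by rewrite st.
  have e2 := sub_quotient_unique (dQ (sg i) lt_st) sq2.
  have e : isomorphic (nth X s i) (nth X t (sg i)).
    exact: isomorphic_trans e1 (isomorphic_trans e12 (isomorphic_sym e2)).
  by split=> h; apply: isomorphic_trans h _ => //; apply: isomorphic_sym.
have [s ss [fs cs]] := series_filt cc; have [t tt [ft dt]] := series_filt cd.
have [st [sg sgP]] := matching_permutation X (@isomorphic_refl E)
  (@isomorphic_sym E) (@isomorphic_trans E) (uniq X s t fs ft).
move: sg sgP; rewrite -tt st => sg sgP; rewrite -ss; split=> //.
exists sg => i; exists (nth X s i), (nth X t (sg i)); split=> //.
  by apply: cs; rewrite -ss.
by apply: dt; rewrite -tt st.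
Qed.

End Embedding.

(** * Isomorphism classes and systems of representatives *)

Section IsoClasses.
Variable E : preexact.

Definition representatives (Q : E -> Prop) n (S : 'I_n -> E) : Prop :=
  [/\ forall k, Q (S k), forall X, Q X -> exists k, isomorphic X (S k) &
      forall k l, isomorphic (S k) (S l) -> k = l].

Definition class_of (Q : E -> Prop) X (QX : Q X) : iso_class Q :=
  exist _ (isomorphic X) (ex_intro2 _ _ X QX erefl).

Lemma representatives_bij (Q : E -> Prop) n (S : 'I_n -> E) :
  representatives Q S -> exists f : 'I_n -> iso_class Q, bijective f.
Proof.
move=> [QS complete inj].
pose f k := class_of (QS k).
have fS (c : iso_class Q) : exists k, f k = c.
  case: c => C QC; have [X QX eC] := QC; have [k Xk] := complete X QX; exists k.
  apply: eq_exist => /=; rewrite eC; apply: funext => Z; apply: propext.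
  split=> h; first exact: isomorphic_trans Xk h.
  exact: isomorphic_trans (isomorphic_sym Xk) h.
have f_inj : injective f.
  move=> k l /(congr1 sval) /= e; apply: inj; rewrite e; exact: isomorphic_refl.
pose g c := sval (cid (fS c)).
have gK c : f (g c) = c by apply: (svalP (cid (fS c))).
by exists f; exists g => // k; apply: f_inj; rewrite gK.
Qed.

Lemma bij_representatives (Q : E -> Prop) n (f : 'I_n -> iso_class Q) :
  bijective f -> exists S : 'I_n -> E, representatives Q S.
Proof.
move=> [g fK gK].
have /choice[S SP] k : exists X, Q X /\ sval (f k) = isomorphic X.
  by have [X QX e] := svalP (f k); exists X.
exists S; split=> [k|X QX|k l kl].
- by have [] := SP k.
- pose c := class_of QX; exists (g c); have [_] := SP (g c); rewrite gK /= => ->.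
  exact: isomorphic_refl.
- rewrite -(fK k) -(fK l); congr g; move: (SP k) (SP l).
  case: (f k) => C hC; case: (f l) => C' hC' /= [_ eC] [_ eC'].
  apply: eq_exist; rewrite eC eC'.
  apply: funext => Z; apply: propext; split=> h.
    exact: isomorphic_trans (isomorphic_sym kl) h.
  exact: isomorphic_trans kl h.
Qed.

(** A family of pairwise non-isomorphic objects of the largest possible size meets every class,
    since an object outside could be adjoined. *)
Lemma maximal_representatives (Q : E -> Prop) d :
  (forall n (S : 'I_n -> E), (forall k, Q (S k)) ->
    (forall k l, isomorphic (S k) (S l) -> k = l) -> (n <= d)%N) ->
  exists n (S : 'I_n -> E), representatives Q S.
Proof.
move=> bound.
pose V n := exists S : 'I_n -> E, (forall k, Q (S k)) /\
  forall k l, isomorphic (S k) (S l) -> k = l.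
have V0 : exists n, `[< V n >].
  exists 0%N; apply/asboolP.
  have [[X _]|nX] := pselect (exists X : E, True).
    by exists (fun=> X); split=> -[].
  exists (fun k : 'I_0 => False_rect E (notF (ltn_ord k))); by split=> -[].
have Vd n : `[< V n >] -> (n <= d)%N by move=> /asboolP[S [QS inj]]; apply: bound QS inj.
case: (ex_maxnP V0 Vd) => n /asboolP[S [QS inj]] nmax; exists n, S; split=> // X QX.
apply: contrapT => nk; suff /asboolP/nmax : V n.+1 by rewrite ltnn.
exists (fun k => oapp S X (unlift ord0 k)); split=> [k|k l].
  by case: unliftP => [j|] _ /=.
case: unliftP => [j|] -> /=; case: unliftP => [j'|] -> //=.
- by move=> /inj ->.
- by move=> h; exfalso; apply: nk; exists j; apply: isomorphic_sym.
- by move=> h; exfalso; apply: nk; exists j'.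
Qed.

End IsoClasses.

(** * Simple objects and dimension vectors *)

Section JordanHolder.
Variable L : pzRingType.
Hypothesis HL : forall M : lmodType L^c, fin_gen M -> bounded_chains (@submod _ M).
Variables (E : preexact) (HE : is_exact E) (D : exact_functor E (modc L)).
Hypothesis Dfaithful : forall (X Y : E) (f : hom X Y), fmor D f = 0 -> f = 0.
Hypothesis Dfull : forall (X Y : E) (g : hom (D X) (D Y)), exists f, fmor D f = g.
Hypothesis Dreflect : forall (X Y Z : E) (f : hom X Y) (g : hom Y Z),
  conflation (fmor D f) (fmor D g) -> conflation f g.

(* Cl 0 is the essential image of D; in the application, Cl k consists of the
   modules whose k-th syzygies lie in it. *)
Variable Cl : nat -> fgmod L -> Prop.
Hypothesis ClD : forall X, Cl 0 (D X).
Hypothesis D_ess : forall M : modc L, Cl 0 M -> exists X, isomorphic (D X) M.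
Hypothesis Cl_ext : forall k (A B C : fgmod L) (i : {linear A -> B})
    (p : {linear B -> C}),
  short_exact i p -> Cl k A -> Cl k C -> Cl k B.
Hypothesis Cl_ker : forall k (A B C : fgmod L) (i : {linear A -> B})
    (p : {linear B -> C}),
  short_exact i p -> Cl k B -> Cl k.+1 C -> Cl k A.
Hypothesis Cl_proj : forall k (P : fgmod L), projm P -> Cl k P.
Hypothesis Cl_sub : forall k (M : fgmod L), Cl k M -> Cl k.+1 M.
Hypothesis Cl_top : exists r, forall M, Cl r M.

Implicit Types X Y Z W Q : E.
Implicit Types M N : fgmod L.

Local Notation dm := (dm D).

Lemma ess_linear M : Cl 0 M -> exists X (a : {linear D X -> M}) (b : {linear M -> D X}),
  (forall x, b (a x) = x) /\ (forall x, a (b x) = x).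
Proof.
move=> /D_ess[X [a [b ba ab]]]; exists X, a, b; split=> x.
  by rewrite -[RHS]/((idm (D X) : {linear D X -> D X}) x) -ba.
by rewrite -[RHS]/((idm (M : modc L) : {linear M -> M}) x) -ab.
Qed.

Lemma ses_iso3 (A B C A' B' C' : fgmod L) (i : {linear A -> B}) (p : {linear B -> C})
    (a : {linear A' -> A}) (b : {linear B' -> B}) (b' : {linear B -> B'})
    (c : {linear C -> C'}) :
  short_exact i p -> injective a -> surj_map a ->
  (forall x, b' (b x) = x) -> (forall x, b (b' x) = x) -> injective c -> surj_map c ->
  short_exact (b' \o (i \o a) : {linear A' -> B'}) (c \o (p \o b) : {linear B' -> C'}).
Proof.
move=> [inj ex surj] ia sa bK bK' ic sc; split.
- by move=> x y /= /(congr1 b); rewrite !bK' => /inj/ia.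
- move=> y /=; split=> [e|[x <-]] /=.
    have /ex[x xy] : p (b y) = 0 by apply: ic; rewrite e linear0.
    by have [z zx] := sa x; exists z; rewrite zx xy bK.
  have -> : p (b (b' (i (a x)))) = 0 by rewrite bK'; apply/ex; exists (a x).
  exact: linear0.
- move=> z; have [w <-] := sc z; have [y <-] := surj w.
  by exists (b' y); rewrite /= bK'.
Qed.

Lemma ses_conflation (A B C : fgmod L) (i : {linear A -> B}) (p : {linear B -> C})
    (X Y Z : E) (a : {linear D X -> A}) (b : {linear D Y -> B}) (c : {linear D Z -> C}) :
  short_exact i p -> injective a -> surj_map a -> injective b -> surj_map b ->
  injective c -> surj_map c ->
  exists (f : hom X Y) (g : hom Y Z), conflation f g /\ forall y, c (dm g y) = p (b y).
Proof.
move=> ses ia sa ib sb ic sc.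
have [y|b' b'E] := @factor_inj _ _ _ _ b idfun ib; first exact: sb.
have [y|c' c'E] := @factor_inj _ _ _ _ c idfun ic; first exact: sc.
have [f fE] := dm_full Dfull (b' \o (i \o a) : {linear D X -> D Y}).
have [g gE] := dm_full Dfull (c' \o (p \o b) : {linear D Y -> D Z}).
exists f, g; split=> [|y]; last by rewrite gE /= c'E.
have [|||inj ex surj] := ses_iso3 (b := b) (b' := b') (c := c') ses ia sa _ b'E.
- by move=> x; apply: ib; rewrite b'E.
- by move=> x y /(congr1 c); rewrite !c'E.
- by move=> z; exists (c z); apply: ic; rewrite c'E.
apply/(dm_conflation Dreflect); split=> [x y|y|z].
- by rewrite !fE => /inj.
- by rewrite gE (ex y); split=> -[x <-]; exists x; rewrite fE.
- by have [y <-] := surj z; exists y; rewrite gE.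
Qed.

(** If X is projective in E, take a free cover of D X. Its kernel lies in [Cl 0], so the cover comes
    from a deflation of E, which splits; hence D X is a summand of a free module. *)
Lemma projective_dm X : projective_obj X <-> projm (D X).
Proof.
split=> [pX|pX Y Z p [W [i /(dm_conflation Dreflect)[_ _ sp]]] f]; last first.
  have [g gE] := pX _ _ (dm p) (dm f) sp.
  have [h hE] := dm_full Dfull g; exists h; apply: (dm_inj Dfaithful) => x.
  by rewrite dm_comp hE gE.
have [n [p sp]] := free_cover (D X); have [K [i ses]] := ses_ker HL sp.
have pF : projm (fg_free L n) := @free_proj L n.
have [Y [a [b [ba ab]]]] := ess_linear (Cl_proj 0 pF).
(* [Cl_ker] asks for the quotient only in [Cl 1], hence [Cl_sub]. *)
have [W [u [v [vu uv]]]] := ess_linear (Cl_ker ses (Cl_proj 0 pF) (Cl_sub (ClD X))).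
have [||||||f [g [cfg gE]]] := ses_conflation (a := u) (b := a)
    (c := idfun : {linear D X -> D X}) ses.
- exact: can_inj vu.
- by move=> y; exists (v y).
- exact: can_inj ba.
- by move=> y; exists (b y).
- by [].
- by move=> y; exists y.
have [|h hE] := pX Y X g _ (idm X); first by exists W, f.
have pY : projm (D Y) by apply: proj_retract ba pF.
apply: (proj_retract (i := dm h) (p := dm g)) pY => x.
by rewrite -dm_comp hE dm_id.
Qed.

(** The summands of a projective D X are projective, hence in the essential image of D, so
    decompositions of X and of D X correspond. *)
Lemma indecomposable_dm X : projm (D X) ->
  indecomposable X <-> @indecomposable (modc L) (D X).
Proof.
move=> pX; have zE Y : zero_obj Y <-> @zero_obj (modc L) (D Y).
  by rewrite (dm_zero Dfaithful) zero_modc.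
split=> -[nz ind]; (split; first by move/zE) => A B bip; last first.
  rewrite (zE A) (zE B); apply: ind.
  have [i [j [p [q [e1 e2 e3 e4 e5]]]]] := bip.
  exists (fmor D i), (fmor D j), (fmor D p), (fmor D q).
  by rewrite -!fmor_comp -fmorD e1 e2 e3 e4 e5 !fmor_id !fmor0.
have [i [j [p [q [pi qj pj qi s]]]]] := biproduct_ses bip.
have pA : projm A by apply: proj_retract pi pX.
have pB : projm B by apply: proj_retract qj pX.
have [A' [a [a' [a'a aa']]]] := ess_linear (Cl_proj 0 pA).
have [B' [b [b' [b'b bb']]]] := ess_linear (Cl_proj 0 pB).
have [i1 i1E] := dm_full Dfull (i \o a : {linear D A' -> D X}).
have [j1 j1E] := dm_full Dfull (j \o b : {linear D B' -> D X}).
have [p1 p1E] := dm_full Dfull (a' \o p : {linear D X -> D A'}).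
have [q1 q1E] := dm_full Dfull (b' \o q : {linear D X -> D B'}).
have bip' : biproduct A' B' X.
  exists i1, j1, p1, q1; split; apply: (dm_inj Dfaithful) => x.
  - by rewrite dm_comp dm_id p1E i1E /= pi a'a.
  - by rewrite dm_comp dm_id q1E j1E /= qj b'b.
  - by rewrite dm_comp dm0 p1E j1E /= pj linear0.
  - by rewrite dm_comp dm0 q1E i1E /= qi linear0.
  - by rewrite dm_add !dm_comp dm_id i1E p1E j1E q1E /= aa' bb' s.
have [|] := ind _ _ bip' => /(dm_zero Dfaithful) z0; [left|right]; apply/zero_modc => x.
  by rewrite -(aa' x) (z0 (a' x)) linear0.
by rewrite -(bb' x) (z0 (b' x)) linear0.
Qed.

Lemma indecomposable_projective_dm X :
  indecomposable X /\ projective_obj X <-> indproj (D X).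
Proof.
rewrite projective_dm /indproj.
by split=> -[ind pX]; split=> //; apply/indecomposable_dm.
Qed.

(** One syzygy at a time: [extend_additive] passes from [Cl k] to [Cl k.+1] by free covers, until
    [Cl r] contains every module. *)
Lemma extend_from_image (V : zmodType) (m : fgmod L -> V) : additive_on (Cl 0) m ->
  exists2 m' : fgmod L -> V, additive_on (fun=> True) m' & forall X, m' (D X) = m (D X).
Proof.
move=> addm; have [r Clr] := Cl_top.
suff h k : exists2 m' : fgmod L -> V, additive_on (Cl k) m' &
    forall M, Cl 0 M -> m' M = m M.
  have [m' addm' m'E] := h r; exists m' => [A B C i p ses _ _ _|X]; last exact: m'E.
  by apply: addm' ses _ _ _; apply: Clr.
have Cl0 k' M : Cl 0 M -> Cl k' M by elim: k' => // k' IH /IH; apply: Cl_sub.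
elim: k => [|k [m' addm' m'E]]; first by exists m.
have [||||m'' addm'' m''E] := extend_additive HL (Cl := Cl k) (Cl' := Cl k.+1) _ _ _ _ addm'.
- exact: Cl_ext.
- exact: Cl_ker.
- move=> M; have [n [p sp]] := free_cover M; exists (fg_free L n), p.
  by split=> //; apply/Cl_proj/free_proj.
- exact: Cl_sub.
by exists m'' => // M C0; rewrite m''E ?m'E //; apply: Cl0.
Qed.

Variables (d : nat) (P : 'I_d -> modc L) (T : 'I_d -> fgmod L).
Hypothesis indproj_P : forall k, indproj (P k).
Hypothesis simple_T : forall T', smod T' ->
  exists k (f : {linear T' -> T k}), injective f /\ surj_map f.
Hypothesis dualPT : forall j k, (0 < mult (P j) (T k))%N = (j == k).

Definition dimv M : 'rV[rat]_d := \row_j (mult (P j) M)%:R.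

Lemma dimv_add : additive_on (fun=> True) dimv.
Proof.
move=> A B C i p ses _ _ _; apply/rowP => j; rewrite !mxE.
by rewrite (mult_add HL (proj2 (indproj_P j)) ses) natrD.
Qed.

Lemma dimv_iso M N (f : {linear M -> N}) : injective f -> surj_map f -> dimv M = dimv N.
Proof. exact: additive_iso dimv_add M N f. Qed.

(** A module in [Cl k.+1] has a free cover whose source and kernel lie in [Cl k], and its dimension
    vector is the difference of theirs. *)
Lemma dimv_span n (B : 'M[rat]_(n, d)) :
  (forall X, (dimv (D X) <= B)%MS) -> forall M, (dimv M <= B)%MS.
Proof.
move=> hB M; have [r Clr] := Cl_top; have := Clr M.
elim: r M {Clr} => [|k IH] M CM.
  have [X [a [b [ba ab]]]] := ess_linear CM.
  rewrite -(dimv_iso (f := a)) //; first exact: can_inj ba.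
  by move=> y; exists (b y).
have [n' [p sp]] := free_cover M; have [K [i ses]] := ses_ker HL sp.
have pF := @free_proj L n'.
have CF : Cl k (fg_free L n') by apply: Cl_proj.
have e := dimv_add ses I I I.
have -> : dimv M = dimv (fg_free L n') - dimv K by rewrite e addrC addKr.
rewrite addmx_sub ?eqmx_opp ?IH //.
exact: Cl_ker ses CF CM.
Qed.

Lemma dimv_span_simple n (B : 'M[rat]_(n, d)) :
  (forall Q, simple_obj Q -> (dimv (D Q) <= B)%MS) -> row_full B.
Proof.
move=> hB.
have hX X : (dimv (D X) <= B)%MS.
  have [s fs] := filt_exists HL HE Dfaithful Dfull Dreflect X.
  elim: fs => {X s} [X /(dm_zero Dfaithful) X0|X Y S s f g cfg sS _ IH].
    by rewrite (additive0 dimv_add X0) sub0mx.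
  have /(dm_conflation Dreflect) ses := cfg.
  by rewrite (dimv_add ses I I I) addmx_sub // hB.
rewrite -sub1mx; apply/row_subP => k.
(* By [dualPT] the dimension vector of [T k] is a positive multiple of the k-th unit vector. *)
have -> : row k 1%:M = (mult (P k) (T k))%:R^-1 *: dimv (T k) :> 'rV[rat]_d.
  apply/rowP => j; rewrite !mxE; have := dualPT j k; rewrite eq_sym.
  have [<-|kj] := eqVneq k j => h.
    by rewrite mulVf // pnatr_eq0 -lt0n h.
  by move: h; rewrite lt0n => /negbFE/eqP ->; rewrite mulr0.
exact/scalemx_sub/dimv_span.
Qed.

Lemma multiplicity_nonsimple X s Q : filt X s -> ~ simple_obj Q -> multiplicity Q s = 0%N.
Proof.
move=> fs nQ; elim: fs => // {X s} X Y S s f g _ sS _ IH.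
rewrite /multiplicity -cats1 count_cat [X in (X + _)%N]IH /= asboolF //.
move=> /isomorphic_sym QS; by apply: nQ; apply: (simple_iso HL HE Dfaithful Dfull QS).
Qed.

Lemma filt_unique_from_count (S : 'I_d -> E) :
  representatives (@simple_obj E) S -> filt_unique E.
Proof.
move=> [simS complete injS].
pose B : 'M[rat]_d := \matrix_k dimv (D (S k)).
have dimvD X Y : isomorphic X Y -> dimv (D X) = dimv (D Y).
  move=> /(dm_isomorphic Dfaithful Dfull)/isomorphic_modc[f [inj surj]].
  exact: dimv_iso inj surj.
have full : row_full B.
  apply: dimv_span_simple => Q /complete[k /dimvD ->].
  by have := row_sub k B; rewrite rowK.
have free : row_free B by rewrite row_free_unit -row_full_unit.
have count_dimv X s : filt X s -> dimv (D X) = (\row_k (multiplicity (S k) s)%:R) *m B.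
  elim=> {X s} [X /(dm_zero Dfaithful) X0|X Y Q s f g cfg sQ _ IH].
    rewrite (additive0 dimv_add X0) -[LHS](mul0mx _ B); congr (_ *m _).
    by apply/rowP => k; rewrite !mxE.
  have /(dm_conflation Dreflect) ses := cfg.
  rewrite (dimv_add ses I I I) IH; have [l Ql] := complete Q sQ.
  have -> : \row_k (multiplicity (S k) (rcons s Q))%:R =
      \row_k (multiplicity (S k) s)%:R + delta_mx 0 l :> 'rV[rat]_d.
    apply/rowP => k; rewrite !mxE /multiplicity -cats1 count_cat natrD /= addn0.
    congr (_ + _); congr (_%:R); congr nat_of_bool.
    apply/asboolP/eqP => [h|->]; first by apply: injS; apply: isomorphic_trans h Ql.
    exact: isomorphic_sym.
  by rewrite mulmxDl -rowE rowK (dimvD _ _ Ql).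
move=> X s t fs ft Q.
have [sQ|nQ] := pselect (simple_obj Q); last first.
  by rewrite (multiplicity_nonsimple fs nQ) (multiplicity_nonsimple ft nQ).
have [k Qk] := complete Q sQ.
have multQ u : multiplicity Q u = multiplicity (S k) u.
  apply: eq_count => Y; apply: asbool_equiv_eq; split=> h.
    exact: isomorphic_trans (isomorphic_sym Qk) h.
  exact: isomorphic_trans Qk h.
rewrite !multQ; have e := count_dimv X s fs; rewrite (count_dimv X t ft) in e.
have /rowP/(_ k) := row_free_inj free e.
by rewrite !mxE => /eqP; rewrite eqr_nat => /eqP.
Qed.

(** The vector of multiplicities of the [S k], extended to all modules, is a linear function of the
    dimension vector and takes [S k] to the k-th unit vector. So the n by d matrix of dimension
    vectors has a right inverse. *)
Lemma simple_independent n (S : 'I_n -> E) : filt_unique E ->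
  (forall k, simple_obj (S k)) -> (forall k l, isomorphic (S k) (S l) -> k = l) ->
  (n <= d)%N.
Proof.
move=> uniq simS injS.
(* The value at M is read off any filtration of any object whose image is isomorphic to M;
   uniqueness of multiplicities makes it well defined. *)
pose G M (z : 'rV[rat]_n) := exists X s (a : {linear D X -> M}),
  [/\ filt X s, injective a, surj_map a & z = \row_k (multiplicity (S k) s)%:R].
have Guniq M z z' : G M z -> G M z' -> z = z'.
  move=> [X [s [a [fs ia sa ->]]]] [Y [t [b [ft ib sb ->]]]].
  have [y|b' b'E] := @factor_inj _ _ _ _ b idfun ib; first exact: sb.
  have XY : isomorphic X Y.
    apply/(dm_isomorphic Dfaithful Dfull)/isomorphic_modc.
    exists (b' \o a : {linear D X -> D Y}); split=> [x y /(congr1 b)|y] /=.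
      by rewrite !b'E => /ia.
    by have [x xy] := sa (b y); exists x; apply: ib; rewrite b'E xy.
  have fs' : filt Y s by apply: (filt_iso HL HE Dfaithful Dfull XY).
  by apply/rowP => k; rewrite !mxE (uniq Y s t fs' ft).
pose m M := xget 0 (G M).
have mP M z : G M z -> m M = z.
  by move=> h; apply: (Guniq M _ _ _ h); apply: (@xgetPex _ 0 (G M)); exists z.
have filt_ex := filt_exists HL HE Dfaithful Dfull Dreflect.
have addm : additive_on (Cl 0) m.
  move=> A B C i p ses CA CB CC.
  have [X [a [a' [a'a aa']]]] := ess_linear CA.
  have [Y [b [b' [b'b bb']]]] := ess_linear CB.
  have [Z [c [c' [c'c cc']]]] := ess_linear CC.
  have [ia ib ic] := And3 (can_inj a'a) (can_inj b'b) (can_inj c'c).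
  have sa : surj_map a by move=> y; exists (a' y).
  have sb : surj_map b by move=> y; exists (b' y).
  have sc : surj_map c by move=> y; exists (c' y).
  have [f [g [cfg _]]] := ses_conflation ses ia sa ib sb ic sc.
  have [s fs] := filt_ex X; have [t ft] := filt_ex Z.
  have fst := filt_cat HL HE Dfaithful Dfull Dreflect cfg fs ft.
  rewrite (mP A (\row_k (multiplicity (S k) s)%:R)); last by exists X, s, a.
  rewrite (mP C (\row_k (multiplicity (S k) t)%:R)); last by exists Z, t, c.
  rewrite (mP B (\row_k (multiplicity (S k) (s ++ t))%:R)); last by exists Y, (s ++ t), b.
  by apply/rowP => k; rewrite !mxE /multiplicity count_cat natrD.
have [m' addm' m'E] := extend_from_image addm.
have [l lE] := additive_expansion HL addm' (fun k => proj2 (indproj_P k)) simple_T dualPT.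
suff : (\matrix_k dimv (D (S k)) : 'M_(n, d)) *m \matrix_j l j = 1%:M.
  exact: mulmx1_min.
apply/row_matrixP => k; rewrite row_mul rowK.
have -> : dimv (D (S k)) *m \matrix_j l j = m' (D (S k)).
  rewrite lE mulmx_sum_row; apply: eq_bigr => j _.
  by rewrite mxE rowK.
rewrite m'E (mP _ (\row_i (multiplicity (S i) [:: S k])%:R)); last first.
  exists (S k), [:: S k], idfun; split=> //; first exact: (filt_simple HL HE Dfaithful Dreflect).
  by move=> y; exists y.
apply/rowP => i; rewrite !mxE /multiplicity /= addn0; congr (_%:R).
congr nat_of_bool; rewrite eq_sym; apply/asboolP/eqP => [/injS //|->].
exact: isomorphic_refl.
Qed.

(** Independence bounds every finite family by d, so a complete one exists, of size n <= d. Its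
    dimension vectors span, so the rank d is at most the number n of rows. *)
Lemma simple_representatives : filt_unique E ->
  exists S : 'I_d -> E, representatives (@simple_obj E) S.
Proof.
move=> uniq.
have [n [S repS]] := maximal_representatives (fun n S => @simple_independent n S uniq).
suff nd : n = d by move: S repS; rewrite nd => S repS; exists S.
have [simS complete injS] := repS.
apply/eqP; rewrite eqn_leq (simple_independent uniq simS injS) /=.
have : row_full (\matrix_k dimv (D (S k)) : 'M_(n, d)).
  apply: dimv_span_simple => Q /complete[k].
  move=> /(dm_isomorphic Dfaithful Dfull)/isomorphic_modc[f [inj surj]].
  rewrite (dimv_iso inj surj).
  by have := row_sub k (\matrix_k dimv (D (S k)) : 'M_(n, d)); rewrite rowK.
by move=> /eqP {1}<-; apply: rank_leq_row.
Qed.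

End JordanHolder.

(** * The injective resolution with U placed in degree 0 *)

Section Coresolution.
Variables (L : pzRingType) (U : modc L) (I : inj_resolution U).

(** The augmentation and the differentials become one family, and Ext^j is read at degree j+1. *)
Definition coresolution (j : nat) : fgmod L :=
  if j is k.+1 then I k else U.

Definition coresolution_diff j : {linear coresolution j -> coresolution j.+1} :=
  match j return {linear coresolution j -> coresolution j.+1} with
  | 0 => ir_aug I
  | k.+1 => ir_diff I k
  end%N.

Lemma coresolution_exact j y :
  coresolution_diff j.+1 y = 0 <-> exists x, coresolution_diff j x = y.
Proof. by case: j y => [|j] y; [apply: ir_exact0|apply: ir_exactS]. Qed.

End Coresolution.

(** * The equivalence as a full exact embedding into modules *)

Section Equivalence.
Variables (E : exact_category) (L : pzRingType) (U : modc L).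
Variables (F : exact_functor E (left_perp U)) (G : exact_functor (left_perp U) E).

Lemma comp_iso_id_faithful (C C' : preexact) (A : exact_functor C C')
    (B : exact_functor C' C) : comp_iso_id A B ->
  forall (X Y : C) (f g : hom X Y), fmor A f = fmor A g -> f = g.
Proof.
move=> [eta [iso_eta nat_eta]] X Y f g e; have [t et te] := iso_eta X.
by rewrite -(compm1 f) -(compm1 g) -te !compA !nat_eta e.
Qed.

Hypotheses (GF : comp_iso_id F G) (FG : comp_iso_id G F).

Definition embedding : exact_functor E (modc L) :=
  @ExactFunctor E (modc L) (fun X => sval (F X)) (fun X Y f => fmor F f)
    (fun X => fmor_id F X) (fun X Y Z g f => fmor_comp F g f)
    (fun X Y f g => fmorD F f g) (fun X Y Z f g => @fmor_conflation _ _ F X Y Z f g).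

Lemma embedding_faithful (X Y : E) (f : hom X Y) : fmor embedding f = 0 -> f = 0.
Proof.
move=> f0; apply: (comp_iso_id_faithful GF).
rewrite -[LHS]/(fmor embedding f) f0 -[RHS]/(fmor embedding 0).
by rewrite fmor0.
Qed.

(** The preimage is G(g) conjugated by the natural isomorphism. It is the right one because G is
    faithful and takes F of it to G(g). *)
Lemma embedding_full (X Y : E) (g : hom (embedding X) (embedding Y)) :
  exists f, fmor embedding f = g.
Proof.
have [eta [iso_eta nat_eta]] := GF; have [t et te] := iso_eta X.
have [t' et' te'] := iso_eta Y.
pose g' : hom (F X) (F Y) := g.
exists (eta Y ∘ fmor G g' ∘ t).
apply: (comp_iso_id_faithful FG (f := fmor F _) (g := g')).
have e := nat_eta _ _ (eta Y ∘ fmor G g' ∘ t).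
rewrite -[LHS]comp1m -et' -[t' ∘ eta Y ∘ _]compA -e.
by rewrite -[_ ∘ t ∘ eta X]compA et compm1 compA et' comp1m.
Qed.

(** F is only known to preserve conflations; reflection follows by applying G and transporting along
    the natural isomorphism. *)
Lemma embedding_reflect (X Y Z : E) (f : hom X Y) (g : hom Y Z) :
  conflation (fmor embedding f) (fmor embedding g) -> conflation f g.
Proof.
move=> h; have [eta [iso_eta nat_eta]] := GF.
have hF : conflation (fmor F f) (fmor F g) by exact: h.
apply: (conflation_iso (ec_exact E) (iso_eta X) (iso_eta Y) (iso_eta Z) _ _
  (fmor_conflation G hF)); by rewrite nat_eta.
Qed.

Lemma embedding_ess (M : modc L) :
  (forall i, (0 < i)%N -> Ext_vanishes i M U) -> exists X, isomorphic (embedding X) M.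
Proof.
move=> hM; pose M' : left_perp U := exist _ M hM.
have [eta [iso_eta _]] := FG; have [t et te] := iso_eta M'.
by exists (G M'), (eta M'), t.
Qed.

End Equivalence.

Lemma same_number_trans (E : preexact) (P Q : E -> Prop) d
    (f : 'I_d -> iso_class P) (g : 'I_d -> iso_class Q) :
  bijective f -> bijective g -> same_number_of_iso_classes P Q.
Proof.
move=> [f' ff' f'f] [g' gg' g'g]; exists (g \o f'), (f \o g') => x /=.
  by rewrite gg' f'f.
by rewrite ff' g'g.
Qed.

Theorem theorem5p10 (E : exact_category)
    (R : comPzRingType) (L : pzRingType) (phi : {rmorphism R -> L})
    (U : modc L) :
  artin_algebra phi -> finite_injdim U -> exact_equivalent E (left_perp U) ->
  (JHP E <->
   same_number_of_iso_classes
     (@simple_obj E)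
     (fun X : E => indecomposable X /\ projective_obj X)).
Proof.
move=> artL [I [r Ir]] [F [G [GF FG]]].
have HL := fin_gen_bounded artL.
have HE := ec_exact E.
pose D := embedding F.
have Dfaithful := embedding_faithful GF.
have Dfull := embedding_full GF FG.
have Dreflect := embedding_reflect GF.
pose J := coresolution I; pose dJ := coresolution_diff I.
have J_exact : forall j y, dJ j.+1 y = 0 <-> exists x, dJ j x = y.
  exact: coresolution_exact.
have J_inj0 : injective (dJ 0%N) := ir_aug_inj (i := I).
have J_ext j : forall (M N : fgmod L) (i : {linear M -> N}) (f : {linear M -> J j.+1}),
    injective i -> exists g : {linear N -> J j.+1}, forall x, g (i x) = f x.
  exact: (injective_modc (@ir_injective _ _ I j)).
(* For j > 0, [lifts dJ j M] stands for Ext^j(M, U) = 0, so [Cl k] requires this vanishing in all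
   degrees above k. *)
pose Cl k (M : fgmod L) := forall j, (k < j)%N -> lifts dJ j M.
have Cl0E (M : modc L) : (forall i, (0 < i)%N -> Ext_vanishes i M U) <-> Cl 0%N M.
  by split=> h [//|j] j0; apply/(Ext_vanishesE HL J_exact J_inj0 J_ext); apply: h.
have ClD X : Cl 0%N (D X) by apply/Cl0E/(svalP (F X)).
have D_ess (M : modc L) : Cl 0%N M -> exists X, isomorphic (D X) M.
  by move=> /Cl0E; apply: embedding_ess FG M.
have Cl_ext k (A B C : fgmod L) (i : {linear A -> B}) (p : {linear B -> C}) :
    short_exact i p -> Cl k A -> Cl k C -> Cl k B.
  move=> ses CA CC [//|j] kj.
  by apply: (lifts_ext J_exact J_ext ses); [apply: CA|apply: CC].
have Cl_ker k (A B C : fgmod L) (i : {linear A -> B}) (p : {linear B -> C}) :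
    short_exact i p -> Cl k B -> Cl k.+1 C -> Cl k A.
  move=> ses CB CC j kj.
  by apply: (lifts_ker J_exact J_ext ses); [apply: CB|apply: CC].
have Cl_proj k (P : fgmod L) : projm P -> Cl k P.
  by move=> hP j _; apply: (lifts_proj HL J_exact).
have Cl_sub k (M : fgmod L) : Cl k M -> Cl k.+1 M.
  by move=> h j kj; apply: h; apply: ltnW.
have Cl_top : exists r, forall M, Cl r M.
  (* [r] bounds the injective dimension: in a degree j+1 > r the target of [f] is I (j+1) = 0, so
     the zero map lifts it. *)
  exists r => M [//|j] rj f _.
  exists (\0 : {linear M -> coresolution I j.+1}) => x; rewrite linear0.
  have /zero_modc z : zero_obj (I j.+1) by apply: Ir.
  exact/esym/z.
have [d [P [T [[hP sT] completeP injP' simpleT dualPT]]]] := simple_projective_duality HL.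
have indprojE := indecomposable_projective_dm HL Dfaithful Dfull Dreflect ClD D_ess
  Cl_ker Cl_proj Cl_sub.
have /choice[X XP] k : exists X, isomorphic (D X) (P k).
  by apply/D_ess/Cl_proj; case: (hP k).
have isoE := dm_isomorphic Dfaithful Dfull.
have repX : representatives (fun X : E => indecomposable X /\ projective_obj X) X.
  split=> [k|Y /indprojE/completeP[k Yk]|k l /isoE kl].
  - by apply/indprojE; apply: indproj_iso (isomorphic_sym (XP k)) (hP k).
  - by exists k; apply/isoE; apply: isomorphic_trans Yk (isomorphic_sym (XP k)).
  - apply: injP'; apply: isomorphic_trans (isomorphic_sym (XP k)) _.
    exact: isomorphic_trans kl (XP l).
have [g gbij] := representatives_bij repX.
rewrite (JHP_filt_unique HL HE Dfaithful Dfull Dreflect); split=> [uniq|[f fbij]].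
  have [S repS] := simple_representatives HL HE Dfaithful Dfull Dreflect ClD D_ess
    Cl_ext Cl_ker Cl_proj Cl_sub Cl_top hP simpleT dualPT uniq.
  have [s sbij] := representatives_bij repS.
  exact: same_number_trans sbij gbij.
have [f' ff' f'f] := fbij; have [g' gg' g'g] := gbij.
(* Numbering the simple classes by 'I_d through the projective ones is how the equality of numbers
   is used: it gives exactly d representatives. *)
have bij : bijective (f' \o g).
  by exists (g' \o f) => x /=; rewrite ?f'f ?gg' // g'g ff'.
have [S repS] := bij_representatives bij.
exact: (filt_unique_from_count HL HE Dfaithful Dfull Dreflect D_ess
    Cl_ker Cl_proj Cl_top hP dualPT repS).
Qed.
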